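(* Let $X$ be a smooth complex projective variety of complex dimension $m$ and let $n\ge 2$. All cohomology groups of the subcomplex $$0\to E_{n-1}^{n(2m-1)+1}(X,n)\to E_{n-2}^{n(2m-1)+2}(X,n)\to\dots\to E_0^{2nm}(X,n)\to 0$$ of the Kriz model of $X$ (with maps the restrictions of the differential $d$) are zero.
   Context: $X$ is connected of complex dimension $m\ge 1$; $H^*(X)=H^*(X;\mathbb{Q})$; $w\in H^{2m}(X)$ is the fundamental class; $\Delta=w\otimes 1+\dots+1\otimes w\in H^*(X)\otimes H^*(X)\cong H^*(X^2)$ is the class of the diagonal. For $1\le i\ne j\le n$, $p_i^*:H^*(X)\to H^*(X^n)$ and $p_{ij}^*:H^*(X^2)\to H^*(X^n)$ are the pullbacks along the projections $X^n\to X$ and $X^n\to X^2$ to the $i$-th, resp. $(i,j)$-th, factors. The Kriz model $E(X,n)$ is the graded-commutative algebra obtained from the exterior algebra with generators $G_{ij}$ ($1\le i\neq j\le n$), of degree $2m-1$, and coefficients in $H^*(X)^{\otimes n}=H^*(X^n)$, modulo the relations $$G_{ji}=G_{ij};\qquad p_j^*(x)G_{ij}=p_i^*(x)G_{ij}\ (i<j,\ x\in H^*(X));\qquad G_{ik}G_{jk}=G_{ij}G_{jk}-G_{ij}G_{ik}\ (i<j<k).$$ The differential $d$ is the derivation with $d|_{H^*(X)^{\otimes n}}=0$ and $d(G_{ij})=p_{ij}^*(\Delta)$. The model is bigraded, $E(X,n)=\bigoplus_{k,q}E_q^k(X,n)$, where the lower (exterior) degree $q$ is the number of exterior generators $G_{ij}$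 and the upper degree $k$ is the total degree; $d:E_q^k\to E_{q-1}^{k+1}$. *)

(* Defs.v *)
From HB Require Import structures.
From mathcomp Require Import all_boot all_order all_algebra all_field.
From mathcomp Require Import complex.
From mathcomp Require mpoly.
From mathcomp Require Import all_classical all_reals all_analysis.
Set Implicit Arguments.
Unset Strict Implicit.
Unset Printing Implicit Defensive.
Import Order.TTheory GRing.Theory Num.Theory numFieldNormedType.Exports.
Local Open Scope ring_scope.

(* R[i] sealed at the structure numFieldType, so that the norm topology of    *)
(* MathComp-Analysis is inferred for it and for row vectors over it.          *)
Definition cplx (R : realType) : numFieldType := R[i].

Section ProjectiveVarieties.
Context (R : realType) (N : nat).
Local Open Scope classical_set_scope.
Local Open Scope quotient_scope.
Local Notation C := (cplx R).
Local Notation poly := (mpoly.mpoly N.+1 C).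

Definition punctured : set 'rV[C]_N.+1 := [set v | v != 0].

Definition same_line (u v : punctured) : bool := (\val u == \val v)%MS.

Lemma same_line_equiv : equiv_class_of same_line.
Proof.
split; rewrite /same_line.
- by move=> u; rewrite submx_refl.
- by move=> u v; rewrite andbC.
- by move=> v u w /eqmxP uv /eqmxP vw; apply/eqmxP/(eqmx_trans uv vw).
Qed.

Canonical same_line_equiv_rel := EquivRelPack same_line_equiv.

Definition projective_space : topologicalType :=
  quotient_topology {eq_quot same_line_equiv_rel}.

Definition homogeneous (f : poly) : Prop :=
  exists d, forall u, mpoly.mcoeff u f != 0 -> mpoly.mdeg u = d.

Definition hcoords (x : projective_space) : 'rV[C]_N.+1 :=
  \val (repr (x : {eq_quot same_line_equiv_rel})).

(* For homogeneous f, the vanishing of peval f x does not depend on the       *)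
(* representative of x chosen by hcoords.                                     *)
Definition peval (f : poly) (x : projective_space) : C :=
  mpoly.meval (fun j => hcoords x 0 j) f.

Definition zero_locus (F : set poly) : set projective_space :=
  [set x | forall f, F f -> peval f x = 0].

Definition vanishing_ideal (X : set projective_space) : set poly :=
  [set f | homogeneous f /\ forall x, X x -> peval f x = 0].

Definition projective_algebraic (X : set projective_space) : Prop :=
  exists F : set poly, (forall f, F f -> homogeneous f) /\ X = zero_locus F.

(* Zariski tangent space, at a point of C^(N+1) over x, of the affine cone    *)
(* over X; it has dimension 1 + dim T_x X.                                    *)
Definition cone_tangent (X : set projective_space) (x : projective_space) :
    set 'rV[C]_N.+1 :=
  [set u | forall f, vanishing_ideal X f ->
     \sum_j peval (mpoly.mderiv j f) x * u 0 j = 0].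

(* The tangent spaces are those of the reduced variety (all of the vanishing  *)
(* ideal is used), so their being of constant dimension m means that X is     *)
(* smooth of pure dimension m.                                                *)
Definition smooth_of_dim (m : nat) (X : set projective_space) : Prop :=
  forall x, X x -> exists B : 'M[C]_(m.+1, N.+1),
    row_free B /\ forall u, cone_tangent X x u <-> (u <= B)%MS.

Record connected_smooth_projective (m : nat) (X : set projective_space) :
    Prop := {
  csp_nonempty : X !=set0;
  csp_algebraic : projective_algebraic X;
  csp_smooth : smooth_of_dim m X;
  csp_connected : connected X }.

End ProjectiveVarieties.

Section StandardSimplex.
Context (R : realType).
Local Open Scope classical_set_scope.

Definition stdsimplex (k : nat) : set 'rV[R]_k.+1 :=
  [set t | (forall i, 0 <= t 0 i) /\ \sum_i t 0 i = 1].
Arguments stdsimplex k : clear implicits.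

Definition push_coords k l (f : 'I_k.+1 -> 'I_l.+1) (t : 'rV[R]_k.+1) :
    'rV[R]_l.+1 :=
  \row_j \sum_(i | f i == j) t 0 i.

Lemma push_coords_simplex k l (f : 'I_k.+1 -> 'I_l.+1) t :
  stdsimplex k t -> stdsimplex l (push_coords f t).
Proof.
move=> [t0 t1]; split=> [j|]; first by rewrite mxE sumr_ge0.
rewrite -t1 [RHS](partition_big f predT) //=.
by apply: eq_bigr => j _; rewrite mxE.
Qed.

(* The affine map that sends the vertex e_i to the vertex e_(f i).            *)
Definition simplex_map k l (f : 'I_k.+1 -> 'I_l.+1) (t : stdsimplex k) :
    stdsimplex l :=
  SigSub (mem_set (push_coords_simplex f (set_mem (valP t)))).

Lemma push_coords_continuous k l (f : 'I_k.+1 -> 'I_l.+1) :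
  continuous (push_coords f).
Proof.
move=> t A [P nP sP].
have nearP i j : nbhs t [set u | P i j (push_coords f u i j)].
  have add_c : continuous (fun z : R * R => z.1 + z.2).
    exact: (@add_continuous R).
  have coord_c a : f a == j -> continuous (fun u : 'rV[R]_k.+1 => u 0 a).
    by move=> _; exact: coord_continuous.
  have ct := @continuous_big _ _ _ 0 _ add_c _ (index_enum _) _ coord_c.
  have := nP i j; rewrite mxE => nPij.
  rewrite (_ : [set u | _] =
      (fun u : 'rV[R]_k.+1 => \sum_(a | f a == j) u 0 a) @^-1` P i j).
    exact: (ct t _ nPij).
  by apply/funext => u; rewrite /mkset/= mxE.
have nearP' i : nbhs t [set u | forall j, P i j (push_coords f u i j)].
  exact: filter_forall (nearP i).
have nearP'' : nbhs t [set u | forall i j, P i j (push_coords f u i j)].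
  exact: filter_forall nearP'.
apply: (filterS _ nearP'') => u Pu; exact: sP.
Qed.

Lemma simplex_map_continuous k l (f : 'I_k.+1 -> 'I_l.+1) :
  continuous (simplex_map f).
Proof.
apply: continuous_comp_initial => t.
apply: (@continuous_comp _ _ _ (val : stdsimplex k -> _) (push_coords f)).
  exact: initial_continuous.
exact: push_coords_continuous.
Qed.

HB.instance Definition _ k l (f : 'I_k.+1 -> 'I_l.+1) :=
  isContinuous.Build _ _ (simplex_map f)
    (@simplex_map_continuous k l f).

End StandardSimplex.
Arguments stdsimplex R k : clear implicits.

Section SingularCohomology.
Context (R : realType) (T : topologicalType).

Definition singular_simplex (k : nat) := continuousType (stdsimplex R k) T.

Definition restrict_simplex k l (f : 'I_k.+1 -> 'I_l.+1)
    (s : singular_simplex l) : singular_simplex k :=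
  s \o simplex_map f.

Definition cochain (k : nat) := singular_simplex k -> rat.

Definition coboundary k (phi : cochain k) : cochain k.+1 :=
  fun s => \sum_(i < k.+2) (-1) ^+ i * phi (restrict_simplex (lift i) s).

Definition is_cocycle k (phi : cochain k) : Prop :=
  forall s, coboundary phi s = 0.

Definition is_coboundary k : cochain k -> Prop :=
  match k with
  | 0 => fun phi => forall s, phi s = 0
  | l.+1 => fun phi =>
      exists psi : cochain l, forall s, phi s = coboundary psi s
  end.

Definition cup k l (phi : cochain k) (psi : cochain l) : cochain (k + l) :=
  fun s => phi (restrict_simplex (fun i : 'I_k.+1 => inord i) s) *
           psi (restrict_simplex (fun i : 'I_l.+1 => inord (k + i)) s).

(* H, graded by deg, is the rational cohomology ring H^*(T; Q), where cl k    *)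
(* is the map that sends a k-cocycle to its cohomology class.                 *)
Record is_cohomology_ring (H : falgType rat) (deg : nat -> {vspace H})
    (cl : forall k, cochain k -> H) : Prop := {
  cl_linear : forall k a (phi psi : cochain k),
    is_cocycle phi -> is_cocycle psi ->
    cl k (fun s => a * phi s + psi s) = a *: cl k phi + cl k psi;
  cl_image : forall k x,
    x \in deg k <-> exists phi : cochain k, is_cocycle phi /\ cl k phi = x;
  cl_kernel : forall k (phi : cochain k),
    is_cocycle phi -> (cl k phi = 0 <-> is_coboundary phi);
  cl_cup : forall k l (phi : cochain k) (psi : cochain l),
    is_cocycle phi -> is_cocycle psi ->
    cl (k + l)%N (cup phi psi) = cl k phi * cl l psi;
  cl_unit : cl 0 (fun=> 1) = 1 }.

End SingularCohomology.

Section PoincareDuality.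
Context (m : nat) (H : falgType rat) (deg : nat -> {vspace H}) (w : H).

Record is_graded_algebra : Prop := {
  deg_sum : (\sum_(k < (2 * m).+1) deg k)%VS = fullv;
  deg_direct : directv (\sum_(k < (2 * m).+1) deg k);
  deg_high : forall k, (2 * m < k)%N -> deg k = 0%VS;
  deg_unit : 1 \in deg 0;
  deg_mul : forall k l x y,
    x \in deg k -> y \in deg l -> x * y \in deg (k + l)%N;
  deg_comm : forall k l x y,
    x \in deg k -> y \in deg l -> x * y = (-1) ^+ (k * l) *: (y * x) }.

(* For the cohomology ring of a connected closed oriented 2m-manifold this    *)
(* record holds by Poincare duality when w is the fundamental class. It fixes *)
(* w only up to a nonzero rational factor.                                    *)
Record is_fundamental_class : Prop := {
  fundamental_neq0 : w != 0;
  fundamental_top : deg (2 * m) = <[w]>%VS;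
  duality : forall k x, (k <= 2 * m)%N -> x \in deg k -> x != 0 ->
    exists2 y, y \in deg (2 * m - k) & x * y = w }.

End PoincareDuality.

Section KrizModel.
Context (m n : nat) (H : falgType rat) (deg : nat -> {vspace H}) (w : H).

(* A homogeneous basis of H: the concatenation of bases of the deg k.         *)
Definition hbasis := {k : 'I_(2 * m).+1 & 'I_(\dim (deg k))}.
Definition hdeg (b : hbasis) : nat := tag b.
Definition hvec (b : hbasis) : H := (vbasis (deg (tag b)))`_(tagged b).

Definition hcomp (k : 'I_(2 * m).+1) (x : H) : H :=
  sumv_pi (\sum_(l < (2 * m).+1) deg l)%VS k x.
Definition hcoord (x : H) (b : hbasis) : rat :=
  coord (vbasis (deg (tag b))) (tagged b) (hcomp (tag b) x).

(* Evaluation on the fundamental cycle, normalized by integral w = 1.         *)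
Definition integral (x : H) : rat :=
  coord [tuple w] ord0 (hcomp ord_max x).

(* hdual b is the dual basis for the pairing:                                 *)
(* integral (hvec a * hdual b) = (a == b)%:R.                                 *)
Definition pairing_mx : 'M[rat]_#|{: hbasis}| :=
  \matrix_(a, b) integral (hvec (enum_val a) * hvec (enum_val b)).
Definition hdual (b : hbasis) : H :=
  \sum_c invmx pairing_mx (enum_rank c) (enum_rank b) *: hvec c.

(* The tensor power of H: t f is the coordinate of t on                       *)
(* hvec (f 0) (x) ... (x) hvec (f (n-1)).                                     *)
Definition tensor_index := {ffun 'I_n -> hbasis}.
Definition tensor := {ffun tensor_index -> rat^o}.

Definition tdeg (f : tensor_index) : nat := \sum_i hdeg (f i).

(* Sign of moving each factor (g j) to the left past the (f i) with i > j.    *)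
Definition koszul_sign (f g : tensor_index) : rat :=
  (-1) ^+ (\sum_(i < n) \sum_(j < n | (j < i)%N) hdeg (f i) * hdeg (g j)).

Definition tmul (t u : tensor) : tensor :=
  [ffun h : tensor_index => \sum_f \sum_g koszul_sign f g * t f * u g *
     \prod_i hcoord (hvec (f i) * hvec (g i)) (h i)].

Definition tone : tensor := [ffun f : tensor_index => \prod_i hcoord 1 (f i)].

(* p_i^*(x) = 1 (x) ... (x) x (x) ... (x) 1, with x in position i.            *)
Definition pull (i : 'I_n) (x : H) : tensor :=
  [ffun f : tensor_index => \prod_j hcoord (if j == i then x else 1) (f j)].

(* p_ij^*(Delta), where the class of the diagonal is                          *)
(* Delta = sum_b (-1)^|b| b (x) b^# with b^# the dual basis                   *)
(* (Milnor-Stasheff, Theorem 11.11).                                          *)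
Definition pull_diagonal (i j : 'I_n) : tensor :=
  \sum_(b : hbasis)
    (-1) ^+ hdeg b *: tmul (pull i (hvec b)) (pull j (hdual b)).

(* The exterior algebra over tensor on the G_ij, i != j: a U is the           *)
(* coefficient, written on the left, of the product of the G_e for e in U in  *)
(* increasing order for edge_lt.                                              *)
Definition edge := {e : 'I_n * 'I_n | e.1 != e.2}.
Definition edge_lt (e e' : edge) : bool := (enum_rank e < enum_rank e')%N.
Definition ext := {ffun {set edge} -> tensor}.

(* Moving a tensor past an odd element.                                       *)
Definition twist (t : tensor) : tensor :=
  [ffun f : tensor_index => (-1) ^+ tdeg f * t f].

(* G_S * G_U = shuffle_sign S U * G_(S :|: U) for disjoint S and U.           *)
Definition shuffle_sign (S U : {set edge}) : rat :=
  (-1) ^+ (\sum_(e in S) #|[set e' in U | edge_lt e' e]|).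

Definition emul (a b : ext) : ext :=
  [ffun V : {set edge} => \sum_(S : {set edge} | S \subset V)
     shuffle_sign S (V :\: S) *:
       tmul (a S) (iter #|S| twist (b (V :\: S)))].

Definition coef (t : tensor) : ext :=
  [ffun V : {set edge} => if V == finset.set0 then t else 0].

Definition G (i j : 'I_n) (ij : i != j) : ext :=
  [ffun V : {set edge} =>
     if V == [set (exist _ (i, j) ij : edge)] then tone else 0].

(* The derivation of the exterior algebra that vanishes on tensor and sends   *)
(* G_ij to p_ij^*(Delta), for the sign rule                                   *)
(* d (a b) = d a b + (-1)^|a| a d b.                                          *)
Definition ediff (a : ext) : ext :=
  [ffun V : {set edge} => \sum_(e : edge | e \notin V)
     (-1) ^+ #|[set e' in V | edge_lt e' e]| *:
       tmul (twist (a (e |: V))) (pull_diagonal (val e).1 (val e).2)].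

Inductive kriz_relator : ext -> Prop :=
| relator_sym (i j : 'I_n) (ij : i != j) (ji : j != i) :
    kriz_relator (G ji - G ij)
| relator_pull (i j : 'I_n) (ij : i != j) x : (i < j)%N ->
    kriz_relator (emul (coef (pull j x)) (G ij) - emul (coef (pull i x)) (G ij))
| relator_arnold (i j k : 'I_n) (ij : i != j) (jk : j != k) (ik : i != k) :
    (i < j < k)%N ->
    kriz_relator (emul (G ik) (G jk)
                  - (emul (G ij) (G jk) - emul (G ij) (G ik))).

(* The two-sided ideal of relations: E(X,n) = ext / kriz_ideal.               *)
Inductive kriz_ideal : ext -> Prop :=
| ideal_relator r : kriz_relator r -> kriz_ideal r
| ideal0 : kriz_ideal 0
| idealD a b : kriz_ideal a -> kriz_ideal b -> kriz_ideal (a + b)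
| idealZ (c : rat) a : kriz_ideal a -> kriz_ideal (c *: a)
| idealMl a b : kriz_ideal b -> kriz_ideal (emul a b)
| idealMr a b : kriz_ideal a -> kriz_ideal (emul a b).

(* ext_q^k, whose image in E(X,n) is E_q^k.                                   *)
Definition bihomogeneous (q k : nat) (a : ext) : Prop :=
  forall V f, a V f != 0 -> #|V| = q /\ (tdeg f + q * (2 * m).-1 = k)%N.

(* From n(2m-1)+1 at q = n-1 to 2nm at q = 0.                                 *)
Definition top_degree (q : nat) : nat := n * (2 * m).-1 + (n - q).

(* In terms of representatives in ext: the class of a in                      *)
(* E_q^(top_degree q) is a cycle, resp. a boundary, of the subcomplex, whose  *)
(* term is 0 for q >= n.                                                      *)
Definition top_cycle (q : nat) (a : ext) : Prop :=
  bihomogeneous q (top_degree q) a /\ kriz_ideal (ediff a).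

Definition top_boundary (q : nat) (a : ext) : Prop :=
  exists b : ext,
    (if (q.+1 < n)%N then bihomogeneous q.+1 (top_degree q.+1) b else b = 0) /\
    kriz_ideal (a - ediff b).

Definition top_subcomplex_acyclic : Prop :=
  forall q, (q < n)%N -> forall a, top_cycle q a -> top_boundary q a.

End KrizModel.

(* Main.v *)
(* In the top degree, a forest monomial G_S only supports a one-dimensional   *)
(* space of coefficients, spanned by w on each component of S. Integrating    *)
(* the coefficient over the partial diagonal of S therefore identifies the    *)
(* subcomplex with the Orlik-Solomon algebra of the braid arrangement and its *)
(* derivation G_ij |-> 1, and this complex is contracted by multiplication    *)
(* with a single generator. To avoid a basis of the Kriz model, the integral  *)
(* of t over the partial diagonal is written as the integral over X^n of t    *)
(* times the product of the Delta_ij, ij in S: this is defined for all S,     *)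
(* commutes with the differentials, and kills the defining relations modulo   *)
(* the Arnold relations. Conversely, a top-degree element whose image lies in *)
(* the Orlik-Solomon ideal lies in the ideal of the Kriz model.               *)

Require Import Defs.
From HB Require Import structures.
From mathcomp Require Import all_boot all_order all_algebra all_field.
From mathcomp Require Import all_classical all_reals all_analysis.
From mathcomp Require Import ring zify.
Set Implicit Arguments.
Unset Strict Implicit.
Unset Printing Implicit Defensive.
Import Order.TTheory GRing.Theory Num.Theory numFieldNormedType.Exports.
Local Open Scope ring_scope.

(** Let S be a forest with q edges. Its partial diagonal in X^n is a copy of X^(n-q), and in the
    degrees of the subcomplex the coefficient of G_S has degree 2m(n-q) ([top_degree_tdeg]), the top
    degree of that diagonal. Modulo the relations the coefficient is thus a single number, its
    integral over the diagonal: [reduce_to_lead_tensor] moves every factor to the least vertex of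
    its component and finds there a multiple of w.

    [trace] records these numbers, as integrals over X^n against the product [diagS S] of diagonal
    classes. It carries d to the derivation [del] that sends every generator to 1 ([trace_ediff])
    and the Kriz ideal into [os_ideal] ([trace_ideal]). In the degrees of the subcomplex it is
    injective modulo the ideals ([trace_inj]) and surjective ([trace_wedge_lift]). Edge sets that
    are not forests do no harm: their monomials lie in [os_ideal] ([not_forest_os_ideal]), hence,
    with any coefficient, in the Kriz ideal ([kriz_ideal_tens]).

    For a generator g the derivation rule gives del (g al) = al - g (del al). If a is a cycle with
    trace al, then al is congruent to del (g al), and any b in the subcomplex with trace congruent
    to g al satisfies a = d b in the model. At the left end, q = n-1, the element g al has degree n
    and vanishes modulo [os_ideal], since n edges on n vertices are never a forest
    ([card_os_ideal]); then a itself is zero in the model. *)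

Lemma regular_scaleE (k : rat) (x : rat^o) : k *: x = k * x :> rat.
Proof. by []. Qed.

(** * The exterior algebra on the edges *)

Section SignArithmetic.
Variables u v k s x y : rat.

(** The sign comparisons of [bar_wedge] and [del_wedge]. Powers of -1 appear as plain variables,
    known at most through their squares, so that [ring] applies. *)
Lemma sign_mulACA : u * v * (s * x * y) = s * (u * x) * (v * y).
Proof. by ring. Qed.

Lemma sign_cancell : u * u = 1 -> u * v * (u * s * x * y) = s * (v * x) * y.
Proof.
by move=> uu; transitivity (u * u * (s * (v * x) * y)); [ring|rewrite uu mul1r].
Qed.

Lemma sign_cancelr : v * v = 1 ->
  u * v * (k * v * s * x * y) = s * (k * x) * (u * y).
Proof.
move=> vv; transitivity (v * v * (s * (k * x) * (u * y))); first ring.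
by rewrite vv mul1r.
Qed.

Lemma sign_cancelN : u * u = 1 -> v * v = 1 ->
  k * u * s * (u * x) * y = - (v * s * (-1 * k * x) * (v * y)).
Proof.
move=> uu vv; transitivity (u * u * (k * s * x * y)); first ring.
rewrite uu mul1r.
by transitivity (v * v * (k * s * x * y)); [rewrite vv mul1r|ring].
Qed.

End SignArithmetic.

Section OrlikSolomon.
Import mathcomp.boot.fintype mathcomp.boot.bigop mathcomp.boot.finset.
Variable n : nat.
Local Notation edge := (edge n).
Implicit Types (S U V W : {set edge}) (e f : edge).

(** * Signs of reordered products of edges *)

(** For e outside V, the number of transpositions that bring G_e from the left of G_V to its place
    in increasing order. *)
Definition below e V : nat := #|[set f in V | edge_lt f e]|.

Lemma belowU e V W : [disjoint V & W] ->
  below e (V :|: W) = (below e V + below e W)%N.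
Proof.
move=> dVW; rewrite /below -cardsUI -[LHS]addn0; congr (_ + _)%N.
  by apply: eq_card => f; rewrite !inE andb_orl.
apply/esym/eqP; rewrite cards_eq0; apply/eqP/setP => f; rewrite !inE.
by case fV: (f \in V); rewrite //= (disjointFr dVW fV) /= andbF.
Qed.

Lemma shuffle_signUl S U V : [disjoint S & U] ->
  shuffle_sign (S :|: U) V = shuffle_sign S V * shuffle_sign U V.
Proof.
move=> dSU; rewrite /shuffle_sign -exprD; congr (_ ^+ _).
by rewrite -bigU //; apply: eq_bigl => e; rewrite !inE.
Qed.

Lemma shuffle_signUr S U V : [disjoint U & V] ->
  shuffle_sign S (U :|: V) = shuffle_sign S U * shuffle_sign S V.
Proof.
move=> dUV; rewrite /shuffle_sign -exprD -big_split; congr (_ ^+ _).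
by apply: eq_bigr => e _; apply: belowU.
Qed.

Lemma shuffle_sign0l S : shuffle_sign set0 S = 1.
Proof. by rewrite /shuffle_sign big_set0. Qed.

Lemma shuffle_sign0r S : shuffle_sign S set0 = 1.
Proof.
rewrite /shuffle_sign big1 // => e _; apply/eqP; rewrite cards_eq0.
by apply/eqP/setP => f; rewrite !inE.
Qed.

Lemma shuffle_sign1l e V : shuffle_sign [set e] V = (-1) ^+ below e V.
Proof. by rewrite /shuffle_sign big_set1. Qed.

Lemma shuffle_signK S U : shuffle_sign S U * shuffle_sign S U = 1.
Proof. by rewrite -expr2 sqrr_sign. Qed.

Lemma edge_lt_total e f : e != f -> edge_lt f e = ~~ edge_lt e f.
Proof.
move=> ef; rewrite /edge_lt -leqNgt ltn_neqAle (inj_eq (@ord_inj _)).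
by rewrite (inj_eq enum_rank_inj) eq_sym ef.
Qed.

(** Coming from the right, G_e crosses the edges of V above e; since e is not in V these are the
    edges not below it, [#|V| - below e V] in number. *)
Lemma shuffle_sign1r e V : e \notin V ->
  shuffle_sign V [set e] = (-1) ^+ #|V| * (-1) ^+ below e V.
Proof.
move=> eV; rewrite -exprD /shuffle_sign -signr_odd -[RHS]signr_odd.
congr (_ ^+ nat_of_bool _); rewrite oddD /below.
have -> : (\sum_(f in V) #|[set e' in [set e] | edge_lt e' f]| =
    #|[set f in V | ~~ edge_lt f e]|)%N.
  rewrite -sum1_card [RHS]big_mkcond [LHS]big_mkcond /=; apply: eq_bigr => f _.
  rewrite !inE; case: ifP => //= fV.
  have ef : f != e by apply: contraNneq eV => <-.
  rewrite -(edge_lt_total ef); case: ifP => h.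
    by rewrite (_ : [set _ in _ | _] = [set e]) ?cards1 //; apply/setP => x;
      rewrite !inE andb_idr // => /eqP ->.
  apply/eqP; rewrite cards_eq0; apply/eqP/setP => x; rewrite !inE.
  by case: eqP => //= ->.
have /(congr1 odd) := cardsID [set f | edge_lt f e] V; rewrite oddD.
rewrite (_ : V :&: _ = [set f in V | edge_lt f e]); last first.
  by apply/setP => f; rewrite !inE.
rewrite (_ : V :\: _ = [set f in V | ~~ edge_lt f e]); last first.
  by apply/setP => f; rewrite !inE andbC.
by move=> <-; rewrite addbC addbA addbb.
Qed.

(** The exterior algebra over the rationals on the edges, with the basis and signs of [ext] but
    scalar coefficients. *)
Definition os_ext := {ffun {set edge} -> rat^o}.
Implicit Types a b c : os_ext.

Definition wedge a b : os_ext :=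
  [ffun V : {set edge} => \sum_(S : {set edge} | S \subset V)
     shuffle_sign S (V :\: S) * a S * b (V :\: S)].

Lemma wedge_linearl k a b c : wedge (k *: a + b) c = k *: wedge a c + wedge b c.
Proof.
apply/ffunP => V; rewrite !ffunE scaler_sumr -big_split; apply: eq_bigr => S _.
by rewrite !ffunE !regular_scaleE /=; ring.
Qed.

Lemma wedge_linearr k a b c : wedge c (k *: a + b) = k *: wedge c a + wedge c b.
Proof.
apply/ffunP => V; rewrite !ffunE scaler_sumr -big_split; apply: eq_bigr => S _.
by rewrite !ffunE !regular_scaleE /=; ring.
Qed.

Lemma wedge0l a : wedge 0 a = 0.
Proof.
by apply/ffunP => V; rewrite !ffunE big1 // => S _; rewrite ffunE mulr0 mul0r.
Qed.

Lemma wedge0r a : wedge a 0 = 0.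
Proof. by apply/ffunP => V; rewrite !ffunE big1 // => S _; rewrite ffunE mulr0.
  Qed.

Lemma wedgeDl a b c : wedge (a + b) c = wedge a c + wedge b c.
Proof. by have := wedge_linearl 1 a b c; rewrite !scale1r. Qed.

Lemma wedgeDr a b c : wedge c (a + b) = wedge c a + wedge c b.
Proof. by have := wedge_linearr 1 a b c; rewrite !scale1r. Qed.

Lemma wedgeZl k a c : wedge (k *: a) c = k *: wedge a c.
Proof. by have := wedge_linearl k a 0 c; rewrite wedge0l !addr0. Qed.

Lemma wedgeZr k a c : wedge c (k *: a) = k *: wedge c a.
Proof. by have := wedge_linearr k a 0 c; rewrite wedge0r !addr0. Qed.

Lemma wedgeNl a c : wedge (- a) c = - wedge a c.
Proof. by rewrite -scaleN1r wedgeZl scaleN1r. Qed.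

Lemma wedgeNr a c : wedge c (- a) = - wedge c a.
Proof. by rewrite -scaleN1r wedgeZr scaleN1r. Qed.

Lemma wedgeA a b c : wedge a (wedge b c) = wedge (wedge a b) c.
Proof.
apply/ffunP => V; rewrite !ffunE.
pose F S U := shuffle_sign S (V :\: S) * a S *
  (shuffle_sign U ((V :\: S) :\: U) * b U * c ((V :\: S) :\: U)).
transitivity (\sum_(S : {set edge} | S \subset V)
    \sum_(U : {set edge} | U \subset V :\: S) F S U).
  by apply: eq_bigr => S _; rewrite ffunE mulr_sumr.
(* With T the union of S and U, both triple products become sums over chains S, T, V of nested
   sets. *)
transitivity (\sum_(S : {set edge} | S \subset V)
    \sum_(T : {set edge} | (S \subset T) && (T \subset V)) F S (T :\: S)).
  apply: eq_bigr => S SV.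
  rewrite (reindex_onto (fun T => T :\: S) (fun U => S :|: U)) /=; last first.
    move=> U; rewrite subsetD => /andP[_ dUS].
    by rewrite setDUl setDv set0U; apply/setDidPl.
  apply: eq_bigl => T; apply/andP/andP.
    move=> [TS /eqP <-]; rewrite subsetUl subUset SV; split=> //.
    by rewrite /= (subset_trans TS) ?subsetDl.
  move=> [ST TV]; rewrite setSD //; split=> //; apply/eqP/setP => x.
  by rewrite !inE; case xS: (x \in S) => //=; rewrite (subsetP ST).
rewrite (exchange_big_dep (fun T : {set edge} => T \subset V)) /=; last first.
  by move=> S T _ /andP[].
apply: eq_bigr => T TV; rewrite ffunE mulr_sumr mulr_suml.
apply: congr_big => [//|S|S].
  by rewrite TV andbT andb_idl // => /subset_trans; apply.
move=> /and3P[_ ST _]; rewrite /F.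
have -> : V :\: S :\: (T :\: S) = V :\: T.
  apply/setP => x; rewrite !inE; case xS: (x \in S) => //=.
  by rewrite (subsetP ST).
have -> : V :\: S = (T :\: S) :|: (V :\: T).
  apply/setP => x; rewrite !inE; case xS: (x \in S) => //=.
    by rewrite (subsetP ST).
  by case xT: (x \in T) => //=; rewrite (subsetP TV).
rewrite shuffle_signUr; last first.
  by rewrite -setI_eq0; apply/eqP/setP => x; rewrite !inE; case: (x \in T);
    rewrite ?andbF.
have -> : shuffle_sign T (V :\: T) =
    shuffle_sign S (V :\: T) * shuffle_sign (T :\: S) (V :\: T).
  rewrite -shuffle_signUl; last first.
    by rewrite -setI_eq0 setIDA setIC -setIDA setDv setI0.
  congr shuffle_sign; apply/setP => x; rewrite !inE.
  by case xS: (x \in S) => //=; rewrite (subsetP ST).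
by rewrite /GRing.regular; ring.
Qed.


Definition mono S : os_ext := [ffun V => (V == S)%:R].

Lemma os_ext_mono a : a = \sum_S a S *: mono S.
Proof.
apply/ffunP => V; rewrite sum_ffunE (bigD1 V) //= big1 => [|S SV].
  by rewrite !ffunE eqxx addr0 regular_scaleE mulr1.
by rewrite !ffunE eq_sym (negPf SV) regular_scaleE mulr0.
Qed.

Lemma wedge_monol S a V :
  wedge (mono S) a V =
    if S \subset V then shuffle_sign S (V :\: S) * a (V :\: S) else 0.
Proof.
rewrite ffunE; case: ifP => SV.
  rewrite (bigD1 S) //= big1 => [|U /andP[_ US]].
    by rewrite ffunE eqxx mulr1 addr0.
  by rewrite ffunE (negPf US) mulr0 mul0r.
rewrite big1 // => U UV; rewrite ffunE; case: eqP => [US|]; last by rewrite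
  mulr0 mul0r.
by rewrite -US UV in SV.
Qed.

Lemma wedge_mono_disjoint S U : [disjoint S & U] ->
  wedge (mono S) (mono U) = shuffle_sign S U *: mono (S :|: U).
Proof.
move=> dSU; apply/ffunP => V; rewrite wedge_monol !ffunE regular_scaleE.
case: (eqVneq V (S :|: U)) => [->|VSU].
  rewrite subsetUl mulr1 (_ : _ :\: S = U) ?eqxx ?mulr1 //.
  by rewrite setDUl setDv set0U; apply/setDidPl; rewrite disjoint_sym.
rewrite mulr0; case: ifP => // SV; case: eqP => [VS|]; last by rewrite mulr0.
case/eqP: VSU; rewrite -VS; apply/setP => x; rewrite !inE.
by case xS: (x \in S) => //=; rewrite (subsetP SV).
Qed.

Lemma wedge_mono_meet S U e : e \in S -> e \in U -> wedge (mono S) (mono U) = 0.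
Proof.
move=> eS eU; apply/ffunP => V; rewrite wedge_monol !ffunE.
case: ifP => // SV; case: eqP => [VS|]; last by rewrite mulr0.
by move: eU; rewrite -VS !inE eS.
Qed.

Lemma mono_setD1 e S : e \in S ->
  mono S = shuffle_sign [set e] (S :\ e) *: wedge (mono [set e]) (mono (S :\
    e)).
Proof.
move=> eS; rewrite wedge_mono_disjoint ?disjoints1 ?inE ?eqxx //.
by rewrite scalerA shuffle_signK scale1r setD1K.
Qed.

Lemma wedge1l a : wedge (mono set0) a = a.
Proof.
by apply/ffunP => V; rewrite wedge_monol sub0set setD0 shuffle_sign0l mul1r.
Qed.

Lemma wedge_mono1C e f :
  wedge (mono [set e]) (mono [set f]) = - wedge (mono [set f]) (mono [set e]).
Proof.
case: (eqVneq e f) => [->|ef].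
  by rewrite (@wedge_mono_meet _ _ f) ?inE // oppr0.
have ne : e \notin [set f] by rewrite inE.
have nf : f \notin [set e] by rewrite inE eq_sym.
rewrite !wedge_mono_disjoint ?disjoints1 // -scaleNr (setUC [set f]); congr (_
  *: _).
by rewrite shuffle_sign1l shuffle_sign1r // cards1 expr1 mulN1r opprK.
Qed.

(** The grading involution, which supplies the sign in the derivation rule [del_wedge]. *)
Definition bar a : os_ext := [ffun V : {set edge} => (-1) ^+ #|V| * a V].

(** Contraction with the linear form that is 1 on every edge, that is, the derivation with G_e |->
    1; [ediff] is its analogue with G_e |-> Delta_e. *)
Definition del a : os_ext :=
  [ffun V : {set edge} => \sum_(e : edge | e \notin V)
     (-1) ^+ below e V * a (e |: V)].

Lemma del_linear k a b : del (k *: a + b) = k *: del a + del b.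
Proof.
apply/ffunP => V; rewrite !ffunE scaler_sumr -big_split; apply: eq_bigr => e _.
by rewrite !ffunE mulrDr; congr (_ + _); apply: mulrCA.
Qed.

Lemma bar_linear k a b : bar (k *: a + b) = k *: bar a + bar b.
Proof.
by apply/ffunP => V; rewrite !ffunE mulrDr; congr (_ + _); apply: mulrCA.
Qed.

Lemma bar_wedge a b : bar (wedge a b) = wedge (bar a) (bar b).
Proof.
apply/ffunP => V; rewrite !ffunE mulr_sumr; apply: eq_bigr => S SV.
rewrite !ffunE -[in (-1) ^+ #|V|](setID V S) (setIidPr SV) cardsU.
have -> : S :&: (V :\: S) = set0 by rewrite setIDA setIC -setIDA setDv setI0.
by rewrite cards0 subn0 exprD; apply: sign_mulACA.
Qed.

Lemma del_wedge a b : del (wedge a b) = wedge (del a) b + wedge (bar a) (del b).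
Proof.
apply/ffunP => V; rewrite !ffunE.
pose F S e := shuffle_sign S (V :\: S) * ((-1) ^+ below e S * a (e |: S)) *
  b (V :\: S).
pose F' S e := shuffle_sign S (V :\: S) * ((-1) ^+ #|S| * a S) *
  ((-1) ^+ below e (V :\: S) * b (e |: (V :\: S))).
have sgn2 (k : nat) : (-1) ^+ k * (-1) ^+ k = 1 :> rat by rewrite -expr2
  sqrr_sign.
have setSD1 S : S \subset V -> (V :\: S) :|: S = V.
  move=> SV; apply/setP => x; rewrite !inE.
  by case xS: (x \in S); rewrite ?orbT ?orbF //= (subsetP SV).
have dSD S : [disjoint S & V :\: S].
  by rewrite -setI_eq0 setIDA setIC -setIDA setDv setI0.
(* For e outside V, the subsets of [e |: V] that contain e differentiate a, the others differentiate
   b. *)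
have outer e : e \notin V -> (-1) ^+ below e V * wedge a b (e |: V) =
    \sum_(S : {set edge} | S \subset V) F S e +
    \sum_(S : {set edge} | S \subset V) F' S e.
  move=> eV; rewrite ffunE mulr_sumr (bigID (fun S : {set edge} => e \in S)) /=.
  congr (_ + _).
    rewrite (reindex_onto (fun S => e |: S) (fun S => S :\ e)) /=; last first.
      by move=> S /andP[_ eS]; rewrite setD1K.
    apply: congr_big => [//|S|S /andP[/andP[SV _] /eqP eS]].
      rewrite setU11 andbT subUset sub1set setU11 /=; apply/andP/idP.
        move=> [SeV /eqP eS]; apply/fintype.subsetP => x xS.
        have := subsetP SeV x xS; rewrite !inE => /orP[/eqP xe|//].
        by move: xS; rewrite -eS xe !inE eqxx.
      move=> SV; split; first by apply: (subset_trans SV); rewrite subsetUr.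
      by rewrite setU1K // (contra (subsetP SV e)).
    have {}SV : S \subset V.
      apply/fintype.subsetP => x xS.
      have := subsetP SV x; rewrite !inE xS orbT => /(_ isT)/orP[/eqP xe|//].
      by move: xS; rewrite -eS xe !inE eqxx.
    have neS : e \notin S by apply: contra eV; apply: (subsetP SV).
    have -> : (e |: V) :\: (e |: S) = V :\: S.
      apply/setP => x; rewrite !inE; case: eqP => [->|//] /=.
      by rewrite (negPf eV) andbF.
    rewrite shuffle_signUl ?disjoints1 // shuffle_sign1l /F.
    rewrite -[in below e V](setSD1 S) // belowU; last by rewrite disjoint_sym.
    by rewrite exprD; apply: sign_cancell.
  apply: congr_big => [//|S|S /andP[SeV eS]].
    apply/andP/idP => [[SeV eS]|SV].
      apply/fintype.subsetP => x xS; have := subsetP SeV x xS.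
      by rewrite !inE => /orP[/eqP xe|//]; rewrite -xe xS in eS.
    split; first by apply: (subset_trans SV); rewrite subsetUr.
    by apply: contra eV; apply: (subsetP SV).
  have SV : S \subset V.
    apply/fintype.subsetP => x xS; have := subsetP SeV x xS.
    by rewrite !inE => /orP[/eqP xe|//]; rewrite -xe xS in eS.
  have -> : (e |: V) :\: S = e |: (V :\: S).
    by apply/setP => x; rewrite !inE; case: eqP => [->|//]; rewrite (negPf eS).
  rewrite shuffle_signUr; last by rewrite disjoints1 !inE negb_and eV orbT.
  rewrite shuffle_sign1r // /F' -[in below e V](setSD1 S) //.
  rewrite belowU; last by rewrite disjoint_sym.
  by rewrite exprD; apply: sign_cancelr.
(* Terms with e in V occur only on the right: there both a and b contribute G_e, and removing it
   from one or from the other gives opposite signs. *)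
have cancel e S : e \in V -> S \subset V -> e \in S -> F (S :\ e) e = - F' S e.
  move=> eV SV eS; rewrite /F /F' setD1K //.
  have -> : V :\: (S :\ e) = e |: (V :\: S).
    apply/setP => x; rewrite !inE; case: eqP => [->|//] /=.
    by rewrite eV.
  have cS : #|S| = #|S :\ e|.+1 by rewrite (cardsD1 e S) eS.
  rewrite cS.
  have dUe : [disjoint [set e] & V :\: S] by rewrite disjoints1 !inE eS.
  have dSe : [disjoint [set e] & S :\ e] by rewrite disjoints1 !inE eqxx.
  have -> : shuffle_sign S (V :\: S) =
      (-1) ^+ below e (V :\: S) * shuffle_sign (S :\ e) (V :\: S).
    by rewrite -shuffle_sign1l -shuffle_signUl // setD1K.
  rewrite shuffle_signUr // shuffle_sign1r ?inE ?eqxx // exprS.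
  exact: sign_cancelN.
rewrite (eq_bigr _ outer) big_split /=.
have -> : \sum_(S : {set edge} | S \subset V)
      shuffle_sign S (V :\: S) * del a S * b (V :\: S) =
    \sum_(e | e \notin V) \sum_(S : {set edge} | S \subset V) F S e +
    \sum_(e | e \in V) \sum_(S : {set edge} | (S \subset V) && (e \notin S)) F
      S e.
  transitivity (\sum_(S : {set edge} | S \subset V) \sum_(e | e \notin S) F S
    e).
    by apply: eq_bigr => S _; rewrite ffunE mulr_sumr mulr_suml.
  rewrite (exchange_big_dep predT) //= (bigID (fun e => e \in V)) /= addrC.
  congr (_ + _); apply: eq_bigr => e eV; apply: eq_bigl => S.
  by case SV: (S \subset V); rewrite //= (contra (subsetP SV e)).
have -> : \sum_(S : {set edge} | S \subset V)
      shuffle_sign S (V :\: S) * bar a S * del b (V :\: S) =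
    \sum_(e | e \notin V) \sum_(S : {set edge} | S \subset V) F' S e +
    \sum_(e | e \in V) \sum_(S : {set edge} | (S \subset V) && (e \in S)) F' S
      e.
  transitivity (\sum_(S : {set edge} | S \subset V)
      \sum_(e | e \notin V :\: S) F' S e).
    by apply: eq_bigr => S _; rewrite !ffunE mulr_sumr.
  rewrite (exchange_big_dep predT) //= (bigID (fun e => e \in V)) /= addrC.
  congr (_ + _); apply: eq_bigr => e eV; apply: eq_bigl => S.
    by rewrite !inE (negPf eV) andbF andbT.
  by rewrite !inE eV andbT negbK.
rewrite addrACA [X in _ = _ + X]addrC -[LHS]addr0; congr (_ + _); apply/esym.
rewrite -big_split big1 // => e eV /=; apply/eqP; rewrite addr_eq0; apply/eqP.
rewrite -sumrN [RHS](reindex_onto (fun S => S :\ e) (fun S => e |: S)) /=; last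
  first.
  by move=> S /andP[_ eS]; rewrite setU1K.
apply: congr_big => [//|S|S /andP[SV eS]]; last by rewrite cancel ?opprK.
apply/andP/andP => [[SV eS]|[/andP[SeV _] /eqP eS]].
  by rewrite (subset_trans (subsetDl _ _) SV) setD1K // !inE eqxx.
by rewrite -eS setU11 subUset sub1set eV.
Qed.

End OrlikSolomon.
(** * The Orlik-Solomon ideal *)

Section OrlikSolomonIdeal.
Import mathcomp.boot.fintype mathcomp.boot.bigop mathcomp.boot.finset.
Import mathcomp.boot.path mathcomp.boot.fingraph.
Variable n : nat.
Local Notation edge := (edge n).
Local Notation os_ext := (os_ext n).
Implicit Types (S U V W : {set edge}) (e f : edge) (a b c : os_ext).
Implicit Types i j k v : 'I_n.

Definition gen i j (ij : i != j) : os_ext := mono [set (exist _ (i, j) ij :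
  edge)].

Inductive os_relator : os_ext -> Prop :=
| os_relator_sym i j (ij : i != j) (ji : j != i) :
    os_relator (gen ji - gen ij)
| os_relator_arnold i j k (ij : i != j) (jk : j != k) (ik : i != k) :
    (i < j < k)%N ->
    os_relator (wedge (gen ik) (gen jk)
                - (wedge (gen ij) (gen jk) - wedge (gen ij) (gen ik))).

(* os_ext modulo os_ideal is the Orlik-Solomon algebra of the braid           *)
(* arrangement, i.e. the cohomology of the configuration space of n points    *)
(* in the plane.                                                              *)
Inductive os_ideal : os_ext -> Prop :=
| os_ideal_relator r : os_relator r -> os_ideal r
| os_ideal0 : os_ideal 0
| os_idealD a b : os_ideal a -> os_ideal b -> os_ideal (a + b)
| os_idealZ (x : rat) a : os_ideal a -> os_ideal (x *: a)
| os_idealMl a b : os_ideal b -> os_ideal (wedge a b)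
| os_idealMr a b : os_ideal a -> os_ideal (wedge a b).

Lemma os_idealN a : os_ideal a -> os_ideal (- a).
Proof. by move=> Ja; rewrite -scaleN1r; apply: os_idealZ. Qed.

Lemma os_ideal_sum (I : finType) (P : pred I) (F : I -> os_ext) :
  (forall x, P x -> os_ideal (F x)) -> os_ideal (\sum_(x | P x) F x).
Proof. by move=> JF; apply: big_ind => //; [apply: os_ideal0|apply: os_idealD].
  Qed.

Lemma os_ideal_congr a b : os_ideal (a - b) -> os_ideal b -> os_ideal a.
Proof. by move=> Jab Jb; rewrite -(subrK b a); apply: os_idealD. Qed.

Lemma del0 : del (0 : os_ext) = 0.
Proof. by have := del_linear (-1) (0 : os_ext) 0; rewrite scaler0 add0r
  scaleN1r addNr. Qed.

Lemma delD a b : del (a + b) = del a + del b.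
Proof. by have := del_linear 1 a b; rewrite !scale1r. Qed.

Lemma delN a : del (- a) = - del a.
Proof. by have := del_linear (-1) a 0; rewrite del0 !scaleN1r !addr0. Qed.

Lemma bar0 : bar (0 : os_ext) = 0.
Proof. by have := bar_linear (-1) (0 : os_ext) 0; rewrite scaler0 add0r
  scaleN1r addNr. Qed.

Lemma barD a b : bar (a + b) = bar a + bar b.
Proof. by have := bar_linear 1 a b; rewrite !scale1r. Qed.

Lemma barN a : bar (- a) = - bar a.
Proof. by have := bar_linear (-1) a 0; rewrite bar0 !scaleN1r !addr0. Qed.

Lemma del_mono1 e : del (mono [set e]) = mono set0.
Proof.
apply/ffunP => V; rewrite !ffunE.
have h f : f \notin V -> (f |: V == [set e]) = (f == e) && (V == set0).
  move=> fV; apply/eqP/andP => [fVe|[/eqP -> /eqP ->]]; last by rewrite setU0.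
  have : f \in [set e] by rewrite -fVe setU11.
  rewrite inE => /eqP fe; rewrite fe eqxx; split=> //; apply/set0Pn => -[x xV].
  have : x \in [set e] by rewrite -fVe !inE xV orbT.
  by rewrite inE -fe => /eqP xf; rewrite -xf xV in fV.
case: (eqVneq V set0) => [V0|V0]; last first.
  by rewrite big1 // => f fV; rewrite ffunE h // (negPf V0) andbF mulr0.
rewrite (bigD1 e) ?V0 ?inE //= big1 => [|f /andP[_ fe]]; last first.
  by rewrite ffunE -V0 h ?V0 ?inE // (negPf fe) mulr0.
rewrite ffunE setU0 eqxx addr0 (_ : below _ _ = 0%N) ?mulr1 //.
by apply/eqP; rewrite cards_eq0; apply/eqP/setP => f; rewrite !inE.
Qed.

Lemma bar_mono S : bar (mono S) = (-1) ^+ #|S| *: mono S.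
Proof.
apply/ffunP => V; rewrite !ffunE regular_scaleE.
by case: eqP => [->//|]; rewrite !mulr0.
Qed.

Lemma bar_gen i j (ij : i != j) : bar (gen ij) = - gen ij.
Proof. by rewrite bar_mono cards1 expr1 scaleN1r. Qed.

Lemma wedge1r_mono1 e : wedge (mono [set e]) (mono set0) = mono [set e].
Proof.
by rewrite wedge_mono_disjoint ?shuffle_sign0r ?scale1r ?setU0 // disjoints1
  inE.
Qed.

(** As every generator goes to 1, the Arnold relator goes to (G_jk - G_ik) - (G_jk - G_ij) + (G_ik -
    G_ij) = 0. *)
Lemma del_os_relator r : os_relator r -> del r = 0.
Proof.
case=> [i j ij ji|i j k ij jk ik _].
  by rewrite delD delN !del_mono1 subrr.
rewrite !(delD, delN, del_wedge) !bar_gen !wedgeNl !del_mono1 !wedge1l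
  !wedge1r_mono1.
rewrite -/(gen ij) -/(gen jk) -/(gen ik) [X in _ - (_ + X)]opprB.
by rewrite [X in _ - X]addrA subrK subrr.
Qed.

Lemma bar_os_relator r : os_relator r -> bar r = - r \/ bar r = r.
Proof.
case=> [i j ij ji|i j k ij jk ik _]; [left|right].
  by rewrite barD barN !bar_gen opprB opprK addrC.
have bar2 u v x y (uv : u != v) (xy : x != y) :
    bar (wedge (gen uv) (gen xy)) = wedge (gen uv) (gen xy).
  by rewrite bar_wedge !bar_gen wedgeNl wedgeNr opprK.
by rewrite !(barD, barN) !bar2.
Qed.

(** The two stabilities are proved together because [del] of a product involves [bar]. *)
Lemma os_ideal_bar_del a : os_ideal a -> os_ideal (bar a) /\ os_ideal (del a).
Proof.
elim=> [r Rr||{}a b _ [Ja Ja'] _ [Jb Jb']|x {}a _ [Ja Ja']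
       |{}a b Jb0 [Jb Jb']|{}a b Ja0 [Ja Ja']].
- rewrite del_os_relator //; split; last exact: os_ideal0.
  by case: (bar_os_relator Rr) => ->; [apply: os_idealN|]; apply:
    os_ideal_relator.
- by rewrite bar0 del0; split; apply: os_ideal0.
- by rewrite barD delD; split; apply: os_idealD.
- have := bar_linear x a 0; have := del_linear x a 0; rewrite bar0 del0 !addr0.
  by move=> -> ->; split; apply: os_idealZ.
- by rewrite bar_wedge del_wedge; split;
    [|apply: os_idealD]; apply: os_idealMl.
- by rewrite bar_wedge del_wedge; split;
    [|apply: os_idealD]; apply: os_idealMr.
Qed.


(* The generator G_ij as a total function, with junk value 0 when i = j.      *)
Definition genT i j : os_ext :=
  if insub (i, j) : option edge is Some e then mono [set e] else 0.

Lemma genTE i j (ij : i != j) : genT i j = gen ij.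
Proof. by rewrite /genT insubT. Qed.

Lemma genT_val e : genT (val e).1 (val e).2 = mono [set e].
Proof. by rewrite /genT -surjective_pairing valK. Qed.

Lemma genTC i j k v : wedge (genT i j) (genT k v) = - wedge (genT k v) (genT i
  j).
Proof.
rewrite /genT; case: insubP => [e _ _|_]; last by rewrite wedge0l wedge0r oppr0.
case: insubP => [f _ _|_]; last by rewrite wedge0l wedge0r oppr0.
exact: wedge_mono1C.
Qed.

Lemma genT_sym i j : os_ideal (genT j i - genT i j).
Proof.
case: (eqVneq i j) => [->|ij]; first by rewrite subrr; apply: os_ideal0.
have ji : j != i by rewrite eq_sym.
by rewrite (genTE ij) (genTE ji); apply/os_ideal_relator/os_relator_sym.
Qed.

(** The cyclic form of the Arnold relation. It is invariant under rotation and, modulo the ideal,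
    changes sign under a swap, so that it holds without any ordering of i, j, k. *)
Definition triangle i j k :=
  wedge (genT i j) (genT j k) + wedge (genT j k) (genT k i) +
  wedge (genT k i) (genT i j).

Lemma triangle_rot i j k : triangle i j k = triangle j k i.
Proof. by rewrite /triangle [RHS]addrC addrA. Qed.

Lemma wedge_congr a b c d : os_ideal (a - b) -> os_ideal (c - d) ->
  os_ideal (wedge a c - wedge b d).
Proof.
move=> ab cd; have -> : wedge a c - wedge b d = wedge (a - b) c + wedge b (c -
  d).
  by rewrite wedgeDl wedgeDr wedgeNl wedgeNr addrA subrK.
by apply: os_idealD; [apply: os_idealMr|apply: os_idealMl].
Qed.

Lemma triangle_swap i j k : os_ideal (triangle i j k) -> os_ideal (triangle j i
  k).
Proof.
move=> T; rewrite -[triangle j i k](subrK (- triangle i j k)).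
apply: os_idealD; last exact: os_idealN.
have -> : triangle j i k - - triangle i j k =
    (wedge (genT j i) (genT i k) - wedge (genT i j) (genT k i)) +
    (wedge (genT i k) (genT k j) - wedge (genT k i) (genT j k)) +
    (wedge (genT k j) (genT j i) - wedge (genT j k) (genT i j)).
  rewrite opprK /triangle (genTC k i) (genTC j k) (genTC i j).
  set X := wedge (genT j k) _; set Y := wedge (genT k i) _.
  set Z := wedge (genT i j) _.
  have -> : - X - Y - Z = - Z - Y - X by rewrite addrC [- X - Y]addrC addrA.
  by rewrite addrACA [X in X + _]addrACA.
by apply: os_idealD; [apply: os_idealD|]; apply: wedge_congr; apply: genT_sym.
Qed.

(** Replacing G_ki by G_ik and anticommuting turns [triangle i j k] into the negative of the Arnold
    relator. *)
Lemma triangle_sorted i j k : (i < j < k)%N -> os_ideal (triangle i j k).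
Proof.
move=> ijk; have /andP[lij ljk] := ijk.
have ij : i != j by rewrite neq_ltn lij.
have jk : j != k by rewrite neq_ltn ljk.
have ik : i != k by rewrite neq_ltn (ltn_trans lij ljk).
apply: (@os_ideal_congr _ (- (wedge (gen ik) (gen jk)
                - (wedge (gen ij) (gen jk) - wedge (gen ij) (gen ik))))); last
                  first.
  by apply/os_idealN/os_ideal_relator/os_relator_arnold.
rewrite -(genTE ij) -(genTE jk) -(genTE ik).
have -> : triangle i j k - - (wedge (genT i k) (genT j k) -
      (wedge (genT i j) (genT j k) - wedge (genT i j) (genT i k))) =
    (wedge (genT j k) (genT k i) - wedge (genT j k) (genT i k)) +
    (wedge (genT k i) (genT i j) - wedge (genT i k) (genT i j)).
  rewrite opprK /triangle (genTC i k j k) (genTC i j i k).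
  set A := wedge (genT i j) _; set B := wedge (genT j k) _.
  set C := wedge (genT k i) _; set X := wedge _ _; set Y := wedge _ _.
  by rewrite opprK opprD [- X + _]addrCA -[A + B + C]addrA addrACA subrr add0r
    addrACA.
by apply: os_idealD; apply: wedge_congr; rewrite ?subrr;
  by [apply: genT_sym|apply: os_ideal0].
Qed.

Lemma triangle_ideal i j k : i != j -> j != k -> i != k -> os_ideal (triangle i
  j k).
Proof.
rewrite !neq_ltn => /orP[ij|ji] /orP[jk|kj] /orP[ik|ki].
- by apply: triangle_sorted; rewrite ij.
- by have := ltn_trans (ltn_trans ij jk) ki; rewrite ltnn.
- rewrite triangle_rot; apply: triangle_swap; rewrite -triangle_rot.
  by apply: triangle_sorted; rewrite ik.
- by rewrite -triangle_rot; apply: triangle_sorted; rewrite ki.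
- by apply: triangle_swap; apply: triangle_sorted; rewrite ji.
- by rewrite triangle_rot; apply: triangle_sorted; rewrite jk.
- by have := ltn_trans (ltn_trans kj ji) ik; rewrite ltnn.
- rewrite -triangle_rot; apply: triangle_swap; rewrite triangle_rot.
  by apply: triangle_sorted; rewrite kj.
Qed.

(** * Cycles vanish in the Orlik-Solomon algebra *)

Definition adj S : rel 'I_n :=
  fun i j => [exists e in S, (val e == (i, j)) || (val e == (j, i))].

Lemma adj_sym S : symmetric (adj S).
Proof.
by move=> i j; apply: eq_existsb => e; rewrite [(_ == (i, j)) || _]orbC.
Qed.

Lemma adj_genT S i j : adj S i j ->
  exists2 e, e \in S & val e = (i, j) \/ val e = (j, i).
Proof.
by case/exists_inP => e eS /orP[]/eqP; exists e => //; [left|right].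
Qed.

Lemma genT_adj e i j : val e = (i, j) \/ val e = (j, i) ->
  os_ideal (genT i j - mono [set e]).
Proof.
rewrite -genT_val => -[|] -> /=; first by rewrite subrr; apply: os_ideal0.
exact: genT_sym.
Qed.

(* Peeling off the first edge i v of the path, the Arnold relation turns      *)
(* G_ij G_iv into a multiple of G_vj, where the path from v to j avoids i.    *)
Lemma wedge_cycle S i p : path (adj S) i p -> uniq (i :: p) -> p != [::] ->
  os_ideal (wedge (genT i (last i p)) (mono S)).
Proof.
elim: p i S => // v p IHp i S /andP[/adj_genT[e eS eiv] pathp] /andP[ip up] _
  /=.
have Jiv := genT_adj eiv.
have [p0|pN] := eqVneq p [::].
  rewrite p0 /=; apply: (@os_ideal_congr _ (wedge (mono [set e]) (mono S))).
    by apply: wedge_congr => //; rewrite subrr; apply: os_ideal0.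
  by rewrite (@wedge_mono_meet _ _ _ e) ?inE //; apply: os_ideal0.
set j := last v p.
have jp : j \in p by rewrite /j; case: (p) pN => //= a q _; apply: mem_last.
have vj : v != j by apply: contraTneq up => ->; rewrite /= jp.
have iv : i != v by apply: contraNneq ip => ->; rewrite inE eqxx.
have ij : i != j by apply: contraNneq ip => ->; rewrite inE jp orbT.
(* The rest of the path avoids i, an endpoint of e, so it never uses e. *)
have pathp' : path (adj (S :\ e)) v p.
  have: {in v :: p &, subrel (adj S) (adj (S :\ e))}.
    move=> x y xp yp /exists_inP[f fS fxy]; apply/exists_inP; exists f => //.
    rewrite !inE fS andbT; apply: contraNneq ip => fe; rewrite fe in fxy.
    by case: eiv fxy => -> /orP[]/eqP[] => *; subst.
  by move=> sub; apply: (sub_in_path sub) => //; apply/allP.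
have IH : os_ideal (wedge (genT v j) (mono (S :\ e))) by apply: IHp.
rewrite (mono_setD1 eS) wedgeZr; apply: os_idealZ; rewrite wedgeA.
have step : os_ideal (wedge (genT i j) (mono [set e]) -
    wedge (genT j i - genT i v) (genT v j)).
  have -> : wedge (genT i j) (mono [set e]) - wedge (genT j i - genT i v) (genT
    v j) =
      wedge (genT i j) (mono [set e]) - wedge (genT j i) (genT i v) + triangle
        j i v.
    rewrite /triangle (genTC v j j i) wedgeDl wedgeNl opprD opprK.
    by rewrite !addrA subrK addrAC.
  apply: os_idealD; last by apply: triangle_ideal; rewrite // eq_sym.
  apply: wedge_congr; rewrite -opprB; apply/os_idealN => //; exact: genT_sym.
apply: (@os_ideal_congr _ (wedge (wedge (genT j i - genT i v) (genT v j))
    (mono (S :\ e)))).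
  by rewrite -wedgeNl -wedgeDl; apply: os_idealMr.
by rewrite -wedgeA; apply: os_idealMl.
Qed.

Lemma wedge_cycle_connect S i j : i != j -> connect (adj S) i j ->
  os_ideal (wedge (genT i j) (mono S)).
Proof.
move=> ij /connectP[p pathp jE]; move: ij; rewrite {}jE.
case/shortenP: pathp => q pathq uq _ iq; apply: wedge_cycle => //.
by apply: contraNneq iq => ->.
Qed.

End OrlikSolomonIdeal.
(** * Forests and connected components *)

Section Forests.
Import mathcomp.boot.fintype mathcomp.boot.bigop mathcomp.boot.finset.
Import mathcomp.boot.path mathcomp.boot.fingraph.
Variable n : nat.
Local Notation edge := (edge n).
Implicit Types (S U V W : {set edge}) (e f : edge).
Implicit Types i j k x y z : 'I_n.

Definition conn S : rel 'I_n := connect (adj S).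

Lemma conn_sym S x y : conn S x y = conn S y x.
Proof. by apply: sym_connect_sym; apply: adj_sym. Qed.

Lemma conn_trans S y x z : conn S x y -> conn S y z -> conn S x z.
Proof. exact: connect_trans. Qed.

Lemma conn_sub S U : S \subset U -> subrel (conn S) (conn U).
Proof.
move=> SU; apply: connect_sub => x y /exists_inP[e eS exy]; apply: connect1.
by apply/exists_inP; exists e => //; apply: (subsetP SU).
Qed.

Lemma conn_edge S e : e \in S -> conn S (val e).1 (val e).2.
Proof.
move=> eS; apply: connect1; apply/exists_inP; exists e => //.
by rewrite -surjective_pairing eqxx.
Qed.

Lemma connD1 S e x y : e \in S -> conn S x y ->
  [\/ conn (S :\ e) x y,
      conn (S :\ e) x (val e).1 /\ conn (S :\ e) (val e).2 y |
      conn (S :\ e) x (val e).2 /\ conn (S :\ e) (val e).1 y].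
Proof.
move=> eS /connectP[p]; elim: p x => [|z p IHp] x /=.
  by move=> _ ->; constructor 1; apply: connect0.
move=> /andP[xz pathp] yE; have := IHp z pathp yE.
have [xz'|] : conn (S :\ e) x z \/ val e = (x, z) \/ val e = (z, x).
  have [f fS fxz] := exists_inP xz.
  have [<-|ef] := eqVneq f e.
    by right; case/orP: fxz => /eqP ->; [left|right].
  left; apply: connect1; apply/exists_inP; exists f => //.
  by rewrite !inE ef.
  case=> [zy|[z1 y2]|[z2 y1]].
  - by constructor 1; apply: conn_trans zy.
  - by constructor 2; split=> //; apply: conn_trans z1.
  - by constructor 3; split=> //; apply: conn_trans z2.
case=> ve.
  have [-> ->] : (val e).1 = x /\ (val e).2 = z by rewrite ve.
  case=> [zy|[zx zy]|[zz xy]].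
  - by constructor 2; split=> //; apply: connect0.
  - by constructor 2; split=> //; apply: connect0.
  - by constructor 1.
have [-> ->] : (val e).1 = z /\ (val e).2 = x by rewrite ve.
case=> [zy|[zz xy]|[zx zy]].
- by constructor 3; split=> //; apply: connect0.
- by constructor 1.
- by constructor 3; split=> //; apply: connect0.
Qed.

(** Lets the induction of [kriz_ideal_family] pass from a family c to the shifted family
    [c (S :|: _)]. *)
Lemma connUl S U V x y :
  (forall x y, conn U x y = conn V x y) -> conn (S :|: U) x y = conn (S :|: V)
    x y.
Proof.
have sub A B : (forall x y, conn A x y = conn B x y) ->
    subrel (conn (S :|: A)) (conn (S :|: B)).
  move=> AB; apply: connect_sub => {}x {}y /exists_inP[e].
  rewrite !inE => /orP[eS|eA] exy.
    apply: connect1; apply/exists_inP; exists e => //; by rewrite !inE eS.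
  apply: (conn_sub (subsetUr S B)); rewrite -AB; apply: connect1.
  by apply/exists_inP; exists e.
by move=> UV; apply/idP/idP; apply: sub => // u v; rewrite UV.
Qed.

(** The least vertex of each component: a choice of representatives that depends only on the
    partition, so that [#|leaders S|] counts components. *)
Definition leaders S : {set 'I_n} :=
  [set x | [forall y : 'I_n, conn S x y ==> (x <= y)%N]].

Lemma leadersP S x : reflect (forall y, conn S x y -> (x <= y)%N) (x \in
  leaders S).
Proof.
by rewrite inE; apply: (iffP forallP) => h y; apply/implyP; apply: h.
Qed.

Lemma leaders_eq S U : (forall x y, conn S x y = conn U x y) -> leaders S =
  leaders U.
Proof.
by move=> SU; apply/setP => x; rewrite !inE; apply: eq_forallb => y; rewrite SU.
Qed.

Definition leader S x : 'I_n := [arg min_(y < x | conn S x y) (y : nat)].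

Lemma conn_leader S x : conn S x (leader S x).
Proof. by rewrite /leader; case: arg_minnP => //; apply: connect0. Qed.

Lemma leader_min S x y : conn S x y -> (leader S x <= y)%N.
Proof.
by rewrite /leader; case: arg_minnP => [|z _ h xy]; [apply: connect0|apply: h].
Qed.

Lemma leader_leaders S x : leader S x \in leaders S.
Proof.
apply/leadersP => y ly; apply: leader_min; apply: conn_trans ly.
exact: conn_leader.
Qed.

Lemma leaders_unique S x y :
  x \in leaders S -> y \in leaders S -> conn S x y -> x = y.
Proof.
move=> /leadersP lx /leadersP ly xy; apply/val_inj/eqP.
by rewrite eqn_leq lx // ly // conn_sym.
Qed.

Lemma conn_redundant S e : e \in S -> conn (S :\ e) (val e).1 (val e).2 ->
  forall x y, conn (S :\ e) x y = conn S x y.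
Proof.
move=> eS ce x y; apply/idP/idP; first by apply: conn_sub; apply: subD1set.
case/(connD1 eS) => [//|[xi jy]|[xj iy]].
  by apply: conn_trans xi (conn_trans ce jy).
by rewrite conn_sym in ce; apply: conn_trans xj (conn_trans ce iy).
Qed.

(** A bridge e joins two components of [S :\ e]. Of their leaders the smaller one, a, leads the
    union in S, and the larger one, b, stops being a leader. *)
Lemma leaders_bridge S e : e \in S -> ~~ conn (S :\ e) (val e).1 (val e).2 ->
  exists a b, [/\ b \notin leaders S, leaders (S :\ e) = b |: leaders S,
    a \in leaders S &
    conn (S :\ e) (val e).1 a && conn (S :\ e) (val e).2 b ||
    conn (S :\ e) (val e).1 b && conn (S :\ e) (val e).2 a].
Proof.
move=> eS ce; pose S' := S :\ e.
have sub : subrel (conn S') (conn S) by apply: conn_sub; apply: subD1set.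
have [a [b [ab la lb cabE sep]]] : exists a b : 'I_n, [/\ (a < b)%N,
    a \in leaders S', b \in leaders S',
    conn S a b /\ (conn S' (val e).1 a && conn S' (val e).2 b ||
      conn S' (val e).1 b && conn S' (val e).2 a) &
    forall x y, conn S x y -> [\/ conn S' x y, conn S' x a /\ conn S' b y |
       conn S' x b /\ conn S' a y]].
  pose i := (val e).1; pose j := (val e).2.
  have ci := conn_leader S' i; have cj := conn_leader S' j.
  have li := leader_leaders S' i; have lj := leader_leaders S' j.
  have ci' : conn S' (leader S' i) i by rewrite conn_sym.
  have cj' : conn S' (leader S' j) j by rewrite conn_sym.
  have cij : conn S (leader S' i) (leader S' j).
    by apply: conn_trans (sub _ _ ci') (conn_trans (conn_edge eS) (sub _ _ cj)).
  have [lt|lt|/val_inj eq] := ltngtP (leader S' i) (leader S' j).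
  - exists (leader S' i), (leader S' j); split=> //.
      by split=> //; rewrite ci cj.
    move=> x y /(connD1 eS)[?|[xi jy]|[xj iy]]; first by constructor 1.
      by constructor 2; split; [apply: conn_trans xi ci|apply: conn_trans cj'
        jy].
    by constructor 3; split; [apply: conn_trans xj cj|apply: conn_trans ci' iy].
  - exists (leader S' j), (leader S' i); split=> //.
      by split; [rewrite conn_sym|rewrite ci cj orbT].
    move=> x y /(connD1 eS)[?|[xi jy]|[xj iy]]; first by constructor 1.
      by constructor 3; split; [apply: conn_trans xi ci|apply: conn_trans cj'
        jy].
    by constructor 2; split; [apply: conn_trans xj cj|apply: conn_trans ci' iy].
  - case/negP: ce; apply: (conn_trans ci); rewrite eq.
    exact: cj'.
have [cab ends] := cabE; exists a, b; split; last exact: ends.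
- apply/negP => /leadersP/(_ a); rewrite conn_sym cab => /(_ isT).
  by rewrite leqNgt ab.
- apply/setP => x; rewrite in_setU1; apply/idP/orP.
    move=> lx; have [->|xb] := eqVneq x b; [by left|right].
    apply/leadersP => y /sep[|[xa yb]|[xb' ya]].
    + by apply/leadersP.
    + rewrite (leaders_unique lx la xa); apply: leq_trans (ltnW ab) _.
      by apply: (leadersP _ _ lb).
    + by rewrite (leaders_unique lx lb xb') eqxx in xb.
  case=> [/eqP -> //|/leadersP lx]; apply/leadersP => y xy.
  by apply: lx; apply: sub.
- apply/leadersP => y /sep[|[_ yb]|[ac _]].
  + by apply/leadersP.
  + by apply: leq_trans (ltnW ab) _; apply: (leadersP _ _ lb).
  + by move: ab; rewrite (leaders_unique la lb ac) ltnn.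
Qed.

(* Every S satisfies #|leaders S| + #|S| >= n, with equality when S has no    *)
(* cycle.                                                                     *)
Definition forest S := (#|leaders S| + #|S| == n)%N.

Lemma forest_card S : forest S -> #|leaders S| = (n - #|S|)%N.
Proof. by move=> /eqP fS; have := congr1 (subn^~ #|S|) fS; rewrite addnK. Qed.

Lemma leaders0 : leaders set0 = setT.
Proof.
apply/setP => x; rewrite in_setT; apply/leadersP => y /connectP[p].
by case: p => [_ -> //|z p /= /andP[/exists_inP[e]]]; rewrite inE.
Qed.

Lemma forest0 : forest set0.
Proof. by rewrite /forest leaders0 cardsT card_ord cards0 addn0. Qed.

Lemma leaders_card_ge S : (n <= #|leaders S| + #|S|)%N.
Proof.
have [k] := ubnP #|S|; elim: k => // k IHk in S * => Sk.
have [->|/set0Pn[e eS]] := eqVneq S set0; first by rewrite (eqP forest0).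
have := cardsD1 e S; rewrite eS add1n => cS; rewrite cS ltnS in Sk.
have := IHk (S :\ e) Sk; rewrite cS.
have [ce|ce] := boolP (conn (S :\ e) (val e).1 (val e).2).
  by rewrite (leaders_eq (conn_redundant eS ce)) addnS => /leqW.
have [a [b [bS -> _ _]]] := leaders_bridge eS ce.
by rewrite cardsU1 bS add1n addSn addnS.
Qed.

(** If the ends of e stayed connected in [S :\ e], the leaders would be the same with one edge
    fewer, against [leaders_card_ge]. *)
Lemma forest_bridge S e : forest S -> e \in S ->
  ~~ conn (S :\ e) (val e).1 (val e).2 /\ forest (S :\ e).
Proof.
move=> /eqP fS eS; have := cardsD1 e S; rewrite eS add1n => cS.
have nce : ~~ conn (S :\ e) (val e).1 (val e).2.
  apply/negP => ce; have := leaders_card_ge (S :\ e).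
  by rewrite (leaders_eq (conn_redundant eS ce)) -ltnS -addnS -cS fS ltnn.
split=> //; have [a [b [bS lE _ _]]] := leaders_bridge eS nce.
by rewrite /forest lE cardsU1 bS add1n addSn -addnS -cS fS.
Qed.

(** Removing a bridge leaves a non-forest, so by induction some edge is reached whose ends are
    connected by the others; [wedge_cycle_connect] applies to it. *)
Lemma not_forest_os_ideal S : ~~ forest S -> os_ideal (mono S).
Proof.
have [k] := ubnP #|S|; elim: k => // k IHk in S * => Sk nfS.
have [S0|/set0Pn[e eS]] := eqVneq S set0; first by rewrite S0 forest0 in nfS.
have := cardsD1 e S; rewrite eS add1n => cS; rewrite cS ltnS in Sk.
rewrite (mono_setD1 eS); apply: os_idealZ.
have [ce|ce] := boolP (conn (S :\ e) (val e).1 (val e).2).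
  by rewrite -genT_val; apply: wedge_cycle_connect => //; apply: (valP e).
apply: os_idealMl; apply: IHk => //; apply: contra nfS => /eqP fS.
have [a [b [bS lE _ _]]] := leaders_bridge eS ce.
by apply/eqP; rewrite -[RHS]fS lE cardsU1 bS cS add1n addSn addnS.
Qed.

(** There is at least one component, so [#|leaders S| + #|S|] exceeds n. This is the vanishing
    beyond the left end of the subcomplex. *)
Lemma card_os_ideal S : (0 < n)%N -> (n <= #|S|)%N -> os_ideal (mono S).
Proof.
move=> n0 nS; apply: not_forest_os_ideal; rewrite /forest neq_ltn; apply/orP;
  right.
apply: (leq_ltn_trans nS); rewrite -[ltnLHS]add0n ltn_add2r card_gt0.
by apply/set0Pn; exists (leader S (Ordinal n0)); apply: leader_leaders.
Qed.

End Forests.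
(** * Dual bases of a Poincare duality algebra *)

Section PoincareDualityAlgebra.
Import mathcomp.boot.fintype mathcomp.boot.bigop mathcomp.boot.finset.
Variables (m : nat) (H : falgType rat) (deg : nat -> {vspace H}) (w : H).
Hypotheses (HG : is_graded_algebra m deg) (HF : is_fundamental_class m deg w).
Local Notation hbasis := (hbasis m deg).
Local Notation hcomp := (@hcomp m H deg).
Local Notation hcoord := (@hcoord m H deg).
Local Notation hdeg := (@hdeg m H deg).
Local Notation hvec := (@hvec m H deg).
Local Notation integral := (@Defs.integral m H deg w).
Local Notation hdual := (@hdual m H deg w).
Implicit Types (x y z : H) (a b c : hbasis).

Lemma hcomp_deg (k : 'I_(2 * m).+1) x : hcomp k x \in deg k.
Proof. exact: memv_sum_pi. Qed.

Lemma sum_hcomp x : \sum_k hcomp k x = x.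
Proof. by apply: sumv_pi_sum; rewrite (deg_sum HG) memvf. Qed.

Lemma hcomp_linear (k : 'I_(2 * m).+1) (r : rat) x y :
  hcomp k (r *: x + y) = r *: hcomp k x + hcomp k y.
Proof. exact: linearP. Qed.

Lemma hcomp_homog (k l : 'I_(2 * m).+1) x : x \in deg l ->
  hcomp k x = if k == l then x else 0.
Proof.
move=> xl; pose x' (i : 'I_(2 * m).+1) := if i == l then x else 0.
have x'_deg i : x' i \in deg i by rewrite /x'; case: eqP => [->//|_]; apply:
  mem0v.
have /directv_sum_unique uniq_sum := deg_direct HG.
have := uniq_sum _ x' (fun i _ => hcomp_deg i x) (fun i _ => x'_deg i).
have -> : \sum_i x' i = x.
  by rewrite (bigD1 l) //= /x' eqxx big1 ?addr0 // => i /negPf ->.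
by rewrite sum_hcomp eqxx => /esym/forall_inP/(_ k isT)/eqP.
Qed.

Lemma hvec_deg b : hvec b \in deg (hdeg b).
Proof. by apply: vbasis_mem; rewrite mem_nth // size_tuple. Qed.

Lemma hcoord_linear (r : rat) x y b :
  hcoord (r *: x + y) b = r * hcoord x b + hcoord y b.
Proof. by rewrite /Defs.hcoord hcomp_linear linearP. Qed.

Lemma hcoord0 b : hcoord 0 b = 0.
Proof. by have := hcoord_linear (-1) 0 0 b; rewrite scaler0 addr0 mulN1r addNr.
  Qed.

Lemma hcoordZ (r : rat) x b : hcoord (r *: x) b = r * hcoord x b.
Proof. by have := hcoord_linear r x 0 b; rewrite hcoord0 !addr0. Qed.

Lemma hcoord_sumE (I : finType) (F : I -> H) b :
  hcoord (\sum_i F i) b = \sum_i hcoord (F i) b.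
Proof.
elim/big_rec2: _ => [|i r x _ <-]; first exact: hcoord0.
by have := hcoord_linear 1 (F i) x b; rewrite scale1r mul1r.
Qed.

Lemma hcoord_sum x : x = \sum_b hcoord x b *: hvec b.
Proof.
rewrite -[LHS]sum_hcomp.
rewrite -(@sig_big_dep _ _ _ _ _ predT (fun=> predT)
  (fun (k : 'I_(2 * m).+1) (i : 'I_(\dim (deg k))) =>
    coord (vbasis (deg k)) i (hcomp k x) *: (vbasis (deg k))`_i)).
by apply: eq_bigr => k _; apply: coord_vbasis; apply: hcomp_deg.
Qed.

Lemma hcoord_homog k x b : x \in deg k -> hdeg b != k -> hcoord x b = 0.
Proof.
move=> xk bk; rewrite /Defs.hcoord.
have [k2m|k2m] := ltnP k (2 * m).+1.
  rewrite (@hcomp_homog _ (Ordinal k2m)) // ifF ?linear0 //.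
  by apply/eqP => e; case/eqP: bk; rewrite /Defs.hdeg e.
move: xk; rewrite (deg_high HG k2m) memv0 => /eqP ->.
by rewrite /Defs.hcomp !linear0.
Qed.

Lemma hcoord_hvec a b : hcoord (hvec a) b = (b == a)%:R.
Proof.
rewrite /Defs.hcoord (@hcomp_homog _ (tag a)) ?hvec_deg //.
case: a b => [k i] [l j] /=; case: eqP => [lk|lk] /=; last first.
  by rewrite linear0; case: eqP => // /(congr1 tag).
subst l; rewrite /Defs.hvec /= coord_free ?(basis_free (vbasisP _)) //.
by rewrite -tag_eqE /tag_eq /= eqxx tagged_asE eq_sym.
Qed.

Lemma integral_linear (r : rat) x y :
  integral (r *: x + y) = r * integral x + integral y.
Proof. by rewrite /Defs.integral hcomp_linear linearP. Qed.

Lemma integral0 : integral 0 = 0.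
Proof. by rewrite /Defs.integral /Defs.hcomp !linear0. Qed.

Lemma integralZ (r : rat) x : integral (r *: x) = r * integral x.
Proof. by have := integral_linear r x 0; rewrite integral0 !addr0. Qed.

Lemma integral_sum (I : finType) (F : I -> H) :
  integral (\sum_i F i) = \sum_i integral (F i).
Proof.
elim/big_rec2: _ => [|i y x _ <-]; first exact: integral0.
by have := integral_linear 1 (F i) x; rewrite scale1r mul1r.
Qed.

Lemma integral_homog k x : x \in deg k -> k != (2 * m)%N -> integral x = 0.
Proof.
move=> xk kN; rewrite /Defs.integral.
have [k2m|k2m] := ltnP k (2 * m).+1.
  rewrite (@hcomp_homog _ (Ordinal k2m)) // ifF ?linear0 //.
  by apply/eqP => /(congr1 val) /= e; rewrite e eqxx in kN.
by move: xk; rewrite (deg_high HG k2m) memv0 => /eqP ->; rewrite /Defs.hcomp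
  !linear0.
Qed.

Lemma w_deg : w \in deg (2 * m).
Proof. by rewrite (fundamental_top HF) memv_line. Qed.

Lemma integral_w : integral w = 1.
Proof.
rewrite /Defs.integral (@hcomp_homog _ ord_max) ?eqxx ?w_deg //.
have /(coord_free ord0 ord0) : free [tuple w].
  by rewrite /= (@free_cons _ _ w [::]) span_nil memv0 (fundamental_neq0 HF)
    nil_free.
by rewrite eqxx.
Qed.

Lemma integral_top x : x \in deg (2 * m) -> x = integral x *: w.
Proof.
rewrite (fundamental_top HF) => /vlineP[r ->].
by rewrite integralZ integral_w mulr1.
Qed.

Lemma integral_mulC k l x y : x \in deg k -> y \in deg l ->
  integral (x * y) = (-1) ^+ (k * l) * integral (y * x).
Proof. by move=> xk yl; rewrite (deg_comm HG xk yl) integralZ. Qed.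

Lemma integral_hcompr (k : 'I_(2 * m).+1) x y :
  y \in deg (2 * m - k) -> integral (y * hcomp k x) = integral (y * x).
Proof.
move=> yk; rewrite -[x in RHS]sum_hcomp mulr_sumr integral_sum (bigD1 k) //=.
rewrite big1 ?addr0 // => i ik.
apply: (integral_homog (deg_mul HG yk (hcomp_deg i x))).
apply: contra ik => /eqP e; apply/eqP/val_inj/eqP.
by rewrite -(eqn_add2l (2 * m - k)) e subnK ?leq_ord.
Qed.

(** A nonzero component of x in degree k has, by [duality], a partner y of degree 2m - k with
    integral 1 or -1, and this y does not see the other components. *)
Lemma integral_nondeg_r x : (forall y, integral (y * x) = 0) -> x = 0.
Proof.
move=> x0; rewrite -[x]sum_hcomp big1 // => k _; apply/eqP/negPn/negP => nz.
have [y yk xy] := duality HF (leq_ord k) (hcomp_deg k x) nz.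
have := integral_mulC (hcomp_deg k x) yk; rewrite xy integral_w integral_hcompr
  //.
by rewrite x0 mulr0 => /eqP; rewrite oner_eq0.
Qed.

Lemma integral_nondeg_l x : (forall y, integral (x * y) = 0) -> x = 0.
Proof.
move=> x0; apply: integral_nondeg_r => y.
rewrite [y]hcoord_sum mulr_suml integral_sum big1 // => b _.
rewrite -scalerAl integralZ; apply/eqP; rewrite mulf_eq0; apply/orP; right;
  apply/eqP.
rewrite -[x]sum_hcomp mulr_sumr integral_sum big1 // => k _.
have [bk|bk] := eqVneq (hdeg b + k)%N (2 * m)%N; last first.
  exact: integral_homog (deg_mul HG (hvec_deg b) (hcomp_deg k x)) bk.
rewrite (integral_mulC (hvec_deg b) (hcomp_deg k x)).
apply/eqP; rewrite mulf_eq0; apply/orP; right; apply/eqP.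
transitivity (integral (x * hvec b)); last exact: x0.
rewrite -[x in RHS]sum_hcomp mulr_suml integral_sum (bigD1 k) //=.
rewrite big1 ?addr0 // => i ik.
apply: (integral_homog (deg_mul HG (hcomp_deg i x) (hvec_deg b))).
apply: contra ik => /eqP e; apply/eqP/val_inj/eqP.
by rewrite -(eqn_add2l (hdeg b)) bk addnC e.
Qed.

Lemma pairing_mx_unit : pairing_mx m deg w \in unitmx.
Proof.
rewrite -row_free_unit; apply: inj_row_free => u uP.
pose x := \sum_a u 0 (enum_rank a) *: hvec a.
have x0 : x = 0.
  apply: integral_nondeg_l => y; rewrite [y]hcoord_sum mulr_sumr integral_sum.
  rewrite big1 // => b _; rewrite -scalerAr integralZ.
  have /matrixP/(_ 0 (enum_rank b)) := uP; rewrite mxE [RHS]mxE => e.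
  rewrite mulr_suml integral_sum; apply/eqP; rewrite mulf_eq0; apply/orP; right.
  rewrite -[X in _ == X]e [X in _ == X](reindex enum_rank) /=; last first.
    by apply: onW_bij; apply: enum_rank_bij.
  apply/eqP; apply: eq_bigr => a _.
  by rewrite -scalerAl integralZ mxE !enum_rankK.
apply/rowP => i; rewrite mxE; have := congr1 (hcoord^~ (enum_val i)) x0.
rewrite hcoord0 => <-; rewrite /x hcoord_sumE.
rewrite (bigD1 (enum_val i)) //= big1 => [|a ai].
  by rewrite hcoordZ hcoord_hvec eqxx mulr1 addr0 enum_valK.
by rewrite hcoordZ hcoord_hvec eq_sym (negPf ai) mulr0.
Qed.

Lemma integral_hdual a b : integral (hvec a * hdual b) = (a == b)%:R.
Proof.
have /matrixP/(_ (enum_rank a) (enum_rank b)) := mulmxV pairing_mx_unit.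
rewrite !mxE (inj_eq enum_rank_inj) => <-.
rewrite /Defs.hdual mulr_sumr integral_sum [RHS](reindex enum_rank) /=; last
  first.
  by apply: onW_bij; apply: enum_rank_bij.
by apply: eq_bigr => c _; rewrite -scalerAr integralZ mulrC mxE !enum_rankK.
Qed.

(** A component of [hdual b] in any other degree pairs to zero with every basis vector, hence
    vanishes by nondegeneracy. *)
Lemma hdual_deg b : hdual b \in deg (2 * m - hdeg b).
Proof.
rewrite -[hdual b]sum_hcomp; apply: rpred_sum => k _.
have [<-|kb] := eqVneq (k : nat) (2 * m - hdeg b)%N; first exact: hcomp_deg.
suff -> : hcomp k (hdual b) = 0 by apply: mem0v.
apply: integral_nondeg_r => y; rewrite [y]hcoord_sum mulr_suml integral_sum.
rewrite big1 // => a _; rewrite -scalerAl integralZ.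
have [ak|ak] := eqVneq (hdeg a + k)%N (2 * m)%N; last first.
  rewrite (integral_homog (deg_mul HG (hvec_deg a) (hcomp_deg k _)) ak).
  by rewrite mulr0.
have ek : (2 * m - k)%N = hdeg a by have := congr1 (subn^~ k) ak; rewrite addnK.
rewrite integral_hcompr; last by rewrite ek hvec_deg.
rewrite integral_hdual; case: eqP => [ab|]; last by rewrite mulr0.
case/eqP: kb; rewrite -ab; apply/eqP.
by rewrite -(eqn_add2l (hdeg a)) ak subnKC ?(leq_ord (tag a)).
Qed.

Lemma hvec_expansion x : x = \sum_b integral (x * hdual b) *: hvec b.
Proof.
rewrite {1}[x]hcoord_sum; apply: eq_bigr => b _; congr (_ *: _).
rewrite [x in RHS]hcoord_sum mulr_suml integral_sum (bigD1 b) //= big1 => [|a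
  ab].
  by rewrite addr0 -scalerAl integralZ integral_hdual eqxx mulr1.
by rewrite -scalerAl integralZ integral_hdual (negPf ab) mulr0.
Qed.

Lemma hdual_expansion x : x = \sum_b integral (hvec b * x) *: hdual b.
Proof.
apply/eqP; rewrite -subr_eq0; apply/eqP; apply: integral_nondeg_r => y.
rewrite [y]hcoord_sum mulr_suml integral_sum big1 // => a _.
rewrite -scalerAl integralZ mulrBr; apply/eqP; rewrite mulf_eq0; apply/orP;
  right.
rewrite -scaleN1r addrC integral_linear mulN1r addrC subr_eq0; apply/eqP.
rewrite mulr_sumr integral_sum (bigD1 a) //= big1 => [|b ba].
  by rewrite addr0 -scalerAr integralZ integral_hdual eqxx mulr1.
by rewrite -scalerAr integralZ integral_hdual eq_sym (negPf ba) mulr0.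
Qed.

End PoincareDualityAlgebra.
(** * The tensor power of a graded algebra *)

Section TensorPower.
Import mathcomp.boot.fintype mathcomp.boot.bigop mathcomp.boot.finset.
Variables (m n : nat) (H : falgType rat) (deg : nat -> {vspace H}).
Hypothesis HG : is_graded_algebra m deg.
Local Notation hbasis := (hbasis m deg).
Local Notation hcoord := (@hcoord m H deg).
Local Notation hdeg := (@hdeg m H deg).
Local Notation hvec := (@hvec m H deg).
Local Notation tensor := (tensor m n deg).
Local Notation tensor_index := (tensor_index m n deg).
Local Notation tone := (tone m n deg).
Local Notation pull := (@pull m n H deg).
Implicit Types (t u v : tensor) (f g h : tensor_index) (i j k : 'I_n).
Implicit Types (x y z : 'I_n -> H) (a b c : 'I_n -> nat).

Definition pure x : tensor := [ffun f : tensor_index => \prod_j hcoord (x j) (f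
  j)].

Definition elem f : tensor := pure (fun i => hvec (f i)).

Lemma eq_pure x y : x =1 y -> pure x = pure y.
Proof.
by move=> xy; apply/ffunP => f; rewrite !ffunE; apply: eq_bigr => i _; rewrite
  xy.
Qed.

Lemma elemE f g : elem f g = (g == f)%:R.
Proof.
rewrite ffunE; under eq_bigr do rewrite (hcoord_hvec HG).
case: eqP => [->|/eqP gf]; first by rewrite big1 // => i _; rewrite eqxx.
have [i gfi] : exists i, g i != f i.
  apply/existsP; apply: contraNT gf => /existsPn gf; apply/eqP/ffunP => i.
  exact/eqP/negPn/gf.
by rewrite (bigD1 i) //= (negPf gfi) mul0r.
Qed.

Lemma tensor_sum t : t = \sum_f t f *: elem f.
Proof.
apply/ffunP => g; rewrite sum_ffunE (bigD1 g) //= big1 => [|f fg].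
  by rewrite ffunE elemE eqxx addr0 regular_scaleE mulr1.
by rewrite ffunE elemE eq_sym (negPf fg) regular_scaleE mulr0.
Qed.

(** Reduces linear identities to the basis tensors, on which [tmul_pure] computes products with one
    explicit sign. *)
Lemma tensor_lin_ext (V : lmodType rat) (F K : tensor -> V) :
  (forall r t u, F (r *: t + u) = r *: F t + F u) ->
  (forall r t u, K (r *: t + u) = r *: K t + K u) ->
  (forall f, F (elem f) = K (elem f)) -> F =1 K.
Proof.
move=> Flin Klin FK t.
have lin0 (L : tensor -> V) : (forall r t u, L (r *: t + u) = r *: L t + L u) ->
    L 0 = 0.
  by move=> Llin; have := Llin (-1) 0 0; rewrite scaler0 addr0 scaleN1r addNr.
rewrite [t]tensor_sum; apply: (big_ind (fun u => F u = K u)).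
- by rewrite !lin0.
- by move=> u v uE vE; have := Flin 1 u v; have := Klin 1 u v; rewrite !scale1r
    uE vE => -> ->.
- move=> f _; have := Flin (t f) (elem f) 0; have := Klin (t f) (elem f) 0.
  by rewrite !lin0 // !addr0 FK => -> ->.
Qed.

Lemma tmul_linearl (r : rat) t u v :
  tmul (r *: t + u) v = r *: tmul t v + tmul u v.
Proof.
apply/ffunP => h; rewrite !ffunE scaler_sumr -big_split; apply: eq_bigr => f _.
rewrite scaler_sumr -big_split; apply: eq_bigr => g _; rewrite !ffunE.
rewrite !regular_scaleE mulrDr !mulrDl; congr (_ + _); rewrite !mulrA.
by do 3!congr (_ * _); apply: mulrC.
Qed.

Lemma tmul_linearr (r : rat) t u v :
  tmul v (r *: t + u) = r *: tmul v t + tmul v u.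
Proof.
apply/ffunP => h; rewrite !ffunE scaler_sumr -big_split; apply: eq_bigr => f _.
rewrite scaler_sumr -big_split; apply: eq_bigr => g _; rewrite !ffunE.
rewrite !regular_scaleE mulrDr !mulrDl; congr (_ + _).
by rewrite mulrCA -!mulrA.
Qed.

Lemma tmul0t t : tmul 0 t = 0.
Proof.
by have := tmul_linearl (-1) 0 0 t; rewrite scaler0 addr0 scaleN1r addNr.
Qed.

Lemma tmult0 t : tmul t 0 = 0.
Proof.
by have := tmul_linearr (-1) 0 0 t; rewrite scaler0 addr0 scaleN1r addNr.
Qed.

Lemma tmulDl t u v : tmul (t + u) v = tmul t v + tmul u v.
Proof. by have := tmul_linearl 1 t u v; rewrite !scale1r. Qed.

Lemma tmulDr t u v : tmul v (t + u) = tmul v t + tmul v u.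
Proof. by have := tmul_linearr 1 t u v; rewrite !scale1r. Qed.

Lemma tmulZl (r : rat) t v : tmul (r *: t) v = r *: tmul t v.
Proof. by have := tmul_linearl r t 0 v; rewrite tmul0t !addr0. Qed.

Lemma tmulZr (r : rat) t v : tmul v (r *: t) = r *: tmul v t.
Proof. by have := tmul_linearr r t 0 v; rewrite tmult0 !addr0. Qed.

Lemma tmulBl t u v : tmul (t - u) v = tmul t v - tmul u v.
Proof. by rewrite tmulDl -[- u]scaleN1r tmulZl scaleN1r. Qed.

Lemma tmulBr t u v : tmul v (t - u) = tmul v t - tmul v u.
Proof. by rewrite tmulDr -[- u]scaleN1r tmulZr scaleN1r. Qed.

Lemma tmul_suml (I : finType) (P : pred I) (F : I -> tensor) t :
  tmul (\sum_(i | P i) F i) t = \sum_(i | P i) tmul (F i) t.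
Proof. by elim/big_rec2: _ => [|i u v _ <-]; rewrite ?tmul0t ?tmulDl. Qed.

Lemma tmul_sumr (I : finType) (P : pred I) (F : I -> tensor) t :
  tmul t (\sum_(i | P i) F i) = \sum_(i | P i) tmul t (F i).
Proof. by elim/big_rec2: _ => [|i u v _ <-]; rewrite ?tmult0 ?tmulDr. Qed.

(** The exponent of [koszul_sign], for arbitrary degree vectors, so that its bilinearity can be
    used. *)
Definition cross a b : nat := (\sum_(i < n) \sum_(j < n | (j < i)%N) a i * b
  j)%N.

Lemma crossDl a b c : cross (fun i => a i + b i)%N c = (cross a c + cross b
  c)%N.
Proof.
rewrite /cross -big_split; apply: eq_bigr => i _; rewrite -big_split.
by apply: eq_bigr => j _; rewrite mulnDl.
Qed.

Lemma crossDr a b c : cross c (fun i => a i + b i)%N = (cross c a + cross c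
  b)%N.
Proof.
rewrite /cross -big_split; apply: eq_bigr => i _; rewrite -big_split.
by apply: eq_bigr => j _; rewrite mulnDr.
Qed.

Lemma cross_sym a b :
  (cross a b + cross b a + \sum_i a i * b i = (\sum_i a i) * (\sum_i b i))%N.
Proof.
have -> : cross b a = (\sum_(i < n) \sum_(j < n | (i < j)%N) a i * b j)%N.
  rewrite /cross (exchange_big_dep predT) //=; apply: eq_bigr => i _.
  by apply: eq_bigr => j _; rewrite mulnC.
rewrite big_distrl /= -!big_split; apply: eq_bigr => i _ /=; rewrite big_distrr
  /=.
rewrite [RHS](bigID (fun j : 'I_n => (j < i)%N)) /= -addnA; congr (_ + _)%N.
rewrite [RHS](bigD1 i) /=; last by rewrite ltnn.
rewrite addnC; congr (_ + _)%N; apply: eq_bigl => j.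
by rewrite -leqNgt ltn_neqAle andbC eq_sym.
Qed.

Definition homog x a := forall i, x i \in deg (a i).

Lemma tmul_pure x y a b : homog x a -> homog y b ->
  tmul (pure x) (pure y) = (-1) ^+ cross a b *: pure (fun i => x i * y i).
Proof.
move=> xa yb; apply/ffunP => h; rewrite !ffunE regular_scaleE.
pose T i p q := hcoord (x i) p * hcoord (y i) q * hcoord (hvec p * hvec q) (h
  i).
have factor i : \sum_p \sum_q T i p q = hcoord (x i * y i) (h i).
  rewrite [x i in RHS](hcoord_sum HG) mulr_suml hcoord_sumE; apply: eq_bigr =>
    p _.
  rewrite [y i in RHS](hcoord_sum HG) mulr_sumr hcoord_sumE; apply: eq_bigr =>
    q _.
  by rewrite -scalerAl -scalerAr !hcoordZ mulrA.
transitivity ((-1) ^+ cross a b * \sum_(f : tensor_index) \sum_(g :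
  tensor_index)
    \prod_i T i (f i) (g i)).
  rewrite mulr_sumr; apply: eq_bigr => f _; rewrite mulr_sumr; apply: eq_bigr
    => g _.
  rewrite !ffunE !big_split /= -!mulrA.
  (* The coordinates of [x i] and [y i] vanish outside the degrees [a i] and [b i]; on the indices
     that remain the Koszul sign is the constant one. *)
  have [/existsP[i]|/existsPn degs] :=
      boolP [exists i, (hdeg (f i) != a i) || (hdeg (g i) != b i)].
    case/orP=> di.
      have -> : \prod_j hcoord (x j) (f j) = 0.
        by rewrite (bigD1 i) //= (hcoord_homog HG (xa i) di) mul0r.
      by rewrite !(mul0r, mulr0).
    have -> : \prod_j hcoord (y j) (g j) = 0.
      by rewrite (bigD1 i) //= (hcoord_homog HG (yb i) di) mul0r.
    by rewrite !(mul0r, mulr0).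
  congr ((-1) ^+ _ * _); apply: eq_bigr => i _; apply: eq_bigr => j _.
  have := degs i; have := degs j; rewrite !negb_or !negbK.
  by move=> /andP[_ /eqP <-] /andP[/eqP <- _].
congr (_ * _); under [RHS]eq_bigr => i _ do rewrite -factor.
rewrite bigA_distr_bigA; apply: eq_bigr => f _.
by rewrite bigA_distr_bigA.
Qed.

Lemma hvec_homog f : homog (fun i => hvec (f i)) (fun i => hdeg (f i)).
Proof. by move=> i; apply: hvec_deg. Qed.

Lemma pureM_homog x y a b : homog x a -> homog y b ->
  homog (fun i => x i * y i) (fun i => a i + b i)%N.
Proof. by move=> xa yb i /=; apply: (deg_mul HG (xa i) (yb i)). Qed.

Lemma tmulA t u v : tmul t (tmul u v) = tmul (tmul t u) v.
Proof.
apply: (tensor_lin_ext (F := fun t => tmul t (tmul u v))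
  (K := fun t => tmul (tmul t u) v)) t => [r t1 t2|r t1 t2|f].
- exact: tmul_linearl.
- by rewrite !tmul_linearl.
apply: (tensor_lin_ext (F := fun u => tmul (elem f) (tmul u v))
  (K := fun u => tmul (tmul (elem f) u) v)) u => [r t1 t2|r t1 t2|g].
- by rewrite tmul_linearl tmul_linearr.
- by rewrite tmul_linearr tmul_linearl.
apply: (tensor_lin_ext (F := fun v => tmul (elem f) (tmul (elem g) v))
  (K := fun v => tmul (tmul (elem f) (elem g)) v)) v => [r t1 t2|r t1 t2|h].
- by rewrite !tmul_linearr.
- by rewrite tmul_linearr.
have [hf hg hh] := And3 (hvec_homog f) (hvec_homog g) (hvec_homog h).
rewrite (tmul_pure hf hg) (tmul_pure hg hh) tmulZr tmulZl.
rewrite (tmul_pure hf (pureM_homog hg hh)) (tmul_pure (pureM_homog hf hg) hh).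
rewrite crossDl crossDr !exprD !scalerA.
rewrite (eq_pure (fun i => mulrA _ _ _)); congr (_ *: _).
by rewrite mulrC -!mulrA; congr (_ * _); apply: mulrC.
Qed.

Lemma one_homog : homog (fun=> 1) (fun=> 0%N).
Proof. by move=> i; apply: deg_unit HG. Qed.

Lemma cross0l a : cross (fun=> 0%N) a = 0%N.
Proof. by rewrite /cross big1 // => i _; rewrite big1. Qed.

Lemma cross0r a : cross a (fun=> 0%N) = 0%N.
Proof. by rewrite /cross big1 // => i _; rewrite big1 // => j _; rewrite muln0.
  Qed.

Lemma tmul1t t : tmul tone t = t.
Proof.
apply: (tensor_lin_ext (F := tmul tone) (K := id)) t => [r t u||f] //.
  exact: tmul_linearr.
have -> : tone = pure (fun=> 1) by apply/ffunP => f'; rewrite !ffunE.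
rewrite (tmul_pure one_homog (hvec_homog f)) cross0l scale1r.
by apply: eq_pure => i; apply: mul1r.
Qed.

Lemma tmult1 t : tmul t tone = t.
Proof.
apply: (tensor_lin_ext (F := fun t => tmul t tone) (K := id)) t => [r t u||f]
  //.
  exact: tmul_linearl.
have -> : tone = pure (fun=> 1) by apply/ffunP => f'; rewrite !ffunE.
rewrite (tmul_pure (hvec_homog f) one_homog) cross0r scale1r.
by apply: eq_pure => i; apply: mulr1.
Qed.

Lemma pureZ (r : 'I_n -> rat) x : pure (fun i => r i *: x i) = (\prod_i r i) *:
  pure x.
Proof.
apply/ffunP => f; rewrite !ffunE regular_scaleE -big_split; apply: eq_bigr => i
  _.
exact: hcoordZ.
Qed.

Lemma pure0 x i : x i = 0 -> pure x = 0.
Proof.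
by move=> xi0; apply/ffunP => f; rewrite !ffunE (bigD1 i) //= xi0 hcoord0 mul0r.
Qed.

Lemma tmul_pureC x y a b : homog x a -> homog y b ->
  tmul (pure x) (pure y) =
    (-1) ^+ ((\sum_i a i) * (\sum_i b i)) *: tmul (pure y) (pure x).
Proof.
move=> xa yb; rewrite (tmul_pure xa yb) (tmul_pure yb xa) scalerA -cross_sym.
rewrite (eq_pure (y := fun i => (-1) ^+ (a i * b i) *: (y i * x i))); last
  first.
  by move=> i /=; apply: (deg_comm HG (xa i) (yb i)).
rewrite pureZ scalerA prodrXr; congr (_ *: _); rewrite !exprD -!mulrA.
congr (_ * _); rewrite [X in _ = _ * X]mulrC mulrA -expr2 sqrr_sign.
by rewrite mul1r.
Qed.

Definition thomog (d : nat) t := forall f, t f != 0 -> tdeg f = d.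

Lemma thomog_pure x a : homog x a -> thomog (\sum_i a i) (pure x).
Proof.
move=> xa f; rewrite ffunE => /prodf_neq0 xf; apply: eq_bigr => i _.
by apply/eqP; apply: contraNT (xf i isT) => di; rewrite (hcoord_homog HG (xa i)
  di).
Qed.

Lemma thomogZ d (r : rat) t : thomog d t -> thomog d (r *: t).
Proof.
by move=> td f; rewrite ffunE => rt; apply: td; apply: contraNneq rt => ->;
  rewrite scaler0.
Qed.

Lemma thomog0 d : thomog d 0.
Proof. by move=> f; rewrite ffunE eqxx. Qed.

Lemma thomogD d t u : thomog d t -> thomog d u -> thomog d (t + u).
Proof.
move=> td ud f; rewrite ffunE; have [tf|/td//] := eqVneq (t f) 0.
by rewrite tf add0r; apply: ud.
Qed.

Lemma thomog_sum d (I : finType) (P : pred I) (F : I -> tensor) :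
  (forall s, P s -> thomog d (F s)) -> thomog d (\sum_(i | P i) F i).
Proof.
by move=> Fd; apply: big_ind => //; [apply: thomog0|apply: thomogD].
Qed.

Lemma thomog_ind d (P : tensor -> Prop) t : P 0 ->
  (forall u v, P u -> P v -> P (u + v)) -> (forall (r : rat) u, P u -> P (r *:
    u)) ->
  (forall f, tdeg f = d -> P (elem f)) -> thomog d t -> P t.
Proof.
move=> P0 PD PZ Pe td; rewrite [t]tensor_sum; apply: big_ind => // f _.
have [->|/td fd] := eqVneq (t f) 0; first by rewrite scale0r.
by apply: PZ; apply: Pe.
Qed.

Lemma thomog_tmul d e t u : thomog d t -> thomog e u -> thomog (d + e) (tmul t
  u).
Proof.
move=> td ue; elim/thomog_ind: td => [|t1 t2 h1 h2|r t1 h1|f <-].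
- by rewrite tmul0t; apply: thomog0.
- by rewrite tmulDl; apply: thomogD.
- by rewrite tmulZl; apply: thomogZ.
elim/thomog_ind: ue => [|t1 t2 h1 h2|r t1 h1|g <-].
- by rewrite tmult0; apply: thomog0.
- by rewrite tmulDr; apply: thomogD.
- by rewrite tmulZr; apply: thomogZ.
rewrite (tmul_pure (hvec_homog f) (hvec_homog g)); apply: thomogZ.
rewrite /tdeg -big_split; apply: thomog_pure.
exact: pureM_homog (hvec_homog f) (hvec_homog g).
Qed.

Lemma thomog_even_central d t u : ~~ odd d -> thomog d t -> tmul t u = tmul u t.
Proof.
move=> ed td; elim/thomog_ind: td => [|t1 t2 h1 h2|r t1 h1|f fd].
- by rewrite tmul0t tmult0.
- by rewrite tmulDl tmulDr h1 h2.
- by rewrite tmulZl tmulZr h1.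
apply: (tensor_lin_ext (F := tmul (elem f)) (K := fun u => tmul u (elem f))) u.
- by move=> r u v; apply: tmul_linearr.
- by move=> r u v; apply: tmul_linearl.
move=> g; rewrite (tmul_pureC (hvec_homog f) (hvec_homog g)) -/(tdeg f) fd.
by rewrite -signr_odd oddM (negPf ed) scale1r.
Qed.

Lemma twist_linear (r : rat) t u : twist (r *: t + u) = r *: twist t + twist u.
Proof.
apply/ffunP => f; rewrite !ffunE !regular_scaleE mulrDr; congr (_ + _).
exact: mulrCA.
Qed.

Lemma twist0 : twist (0 : tensor) = 0.
Proof. by have := twist_linear (-1) 0 0; rewrite scaler0 addr0 scaleN1r addNr.
  Qed.

Lemma twistK t : twist (twist t) = t.
Proof.
by apply/ffunP => f; rewrite !ffunE mulrA -expr2 sqrr_sign mul1r.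
Qed.

Lemma twist_homog d t : thomog d t -> twist t = (-1) ^+ d *: t.
Proof.
move=> td; apply/ffunP => f; rewrite !ffunE regular_scaleE.
by have [->|/td ->//] := eqVneq (t f) 0; rewrite !mulr0.
Qed.

Lemma thomog_elem f : thomog (tdeg f) (elem f).
Proof. exact: thomog_pure (hvec_homog f). Qed.

Lemma twist_tmul t u : twist (tmul t u) = tmul (twist t) (twist u).
Proof.
apply: (tensor_lin_ext (F := fun t => twist (tmul t u))
  (K := fun t => tmul (twist t) (twist u))) t => [r t1 t2|r t1 t2|f].
- by rewrite tmul_linearl twist_linear.
- by rewrite twist_linear tmul_linearl.
apply: (tensor_lin_ext (F := fun u => twist (tmul (elem f) u))
  (K := fun u => tmul (twist (elem f)) (twist u))) u => [r t1 t2|r t1 t2|g].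
- by rewrite tmul_linearr twist_linear.
- by rewrite twist_linear tmul_linearr.
rewrite (twist_homog (thomog_tmul (thomog_elem (f:=f)) (thomog_elem (f:=g)))).
rewrite !(twist_homog (thomog_elem (f:=_))) tmulZl tmulZr scalerA.
by rewrite exprD.
Qed.

Lemma twist_tone : twist tone = tone.
Proof.
rewrite (twist_homog (d := 0)) ?scale1r //.
have -> : tone = pure (fun=> 1) by apply/ffunP => f'; rewrite !ffunE.
by have := thomog_pure one_homog; rewrite big1.
Qed.

Local Notation twist := (@twist m n H deg).

Lemma iter_twist_linear (k : nat) (r : rat) t u :
  iter k twist (r *: t + u) = r *: iter k twist t + iter k twist u.
Proof. by elim: k => //= k ->; apply: twist_linear. Qed.

Lemma iter_twist0 (k : nat) : iter k twist (0 : tensor) = 0.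
Proof. by elim: k => //= k ->; apply: twist0. Qed.

Lemma iter_twist_tmul (k : nat) t u : iter k twist (tmul t u) = tmul (iter k
  twist t) (iter k twist u).
Proof. by elim: k => //= k ->; apply: twist_tmul. Qed.

Lemma iter_twistK (k : nat) t : iter k twist (iter k twist t) = t.
Proof. by elim: k t => //= k IHk t; rewrite -iterS iterSr twistK IHk. Qed.

Lemma iter_twist_even (k : nat) d t : ~~ odd d -> thomog d t -> iter k twist t
  = t.
Proof.
move=> ed td; elim: k => //= k ->; rewrite (twist_homog td).
by rewrite -signr_odd (negPf ed) scale1r.
Qed.

Lemma iter_twistE (k : nat) t f : iter k twist t f = (-1) ^+ (k * tdeg f) * t f.
Proof.
by elim: k => [|k IHk] /=; rewrite ?mul1r // ffunE IHk mulrA -exprD -mulSn.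
Qed.

End TensorPower.
(** * The class of the diagonal *)

Section PulledBackClasses.
Import mathcomp.boot.fintype mathcomp.boot.bigop mathcomp.boot.finset.
Variables (m n : nat) (H : falgType rat) (deg : nat -> {vspace H}) (w : H).
Hypotheses (HG : is_graded_algebra m deg) (HF : is_fundamental_class m deg w).
Local Notation hbasis := (hbasis m deg).
Local Notation hcoord := (@hcoord m H deg).
Local Notation hdeg := (@hdeg m H deg).
Local Notation hvec := (@hvec m H deg).
Local Notation integral := (@Defs.integral m H deg w).
Local Notation hdual := (@hdual m H deg w).
Local Notation tensor := (tensor m n deg).
Local Notation tensor_index := (tensor_index m n deg).
Local Notation pull := (@pull m n H deg).
Local Notation pull_diagonal := (@pull_diagonal m n H deg w).
Local Notation pure := (@pure m n H deg).
Implicit Types (t u v : tensor) (f g h : tensor_index) (i j k : 'I_n).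
Implicit Types (x y z : 'I_n -> H) (b c : hbasis) (p q : H).


Lemma H_lin_ext (V : lmodType rat) (F K : H -> V) :
  (forall (r : rat) p q, F (r *: p + q) = r *: F p + F q) ->
  (forall (r : rat) p q, K (r *: p + q) = r *: K p + K q) ->
  (forall b, F (hvec b) = K (hvec b)) -> F =1 K.
Proof.
move=> Flin Klin FK p.
have lin0 (L : H -> V) : (forall (r : rat) p q, L (r *: p + q) = r *: L p + L
  q) -> L 0 = 0.
  by move=> Llin; have := Llin (-1) 0 0; rewrite scaler0 addr0 scaleN1r addNr.
rewrite [p](hcoord_sum HG); apply: (big_ind (fun q => F q = K q)).
- by rewrite !lin0.
- by move=> q r qE rE; have := Flin 1 q r; have := Klin 1 q r; rewrite !scale1r
    qE rE => -> ->.
- move=> b _; have := Flin (hcoord p b) (hvec b) 0.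
  by have := Klin (hcoord p b) (hvec b) 0; rewrite !lin0 // !addr0 FK => -> ->.
Qed.

Lemma pullE i (p : H) : pull i p = pure (fun j => if j == i then p else 1).
Proof. by []. Qed.

Lemma pull_linear i (r : rat) (p q : H) :
  pull i (r *: p + q) = r *: pull i p + pull i q.
Proof.
have pullF (p' : H) f : pull i p' f = hcoord p' (f i) * \prod_(j | j != i)
  hcoord 1 (f j).
  rewrite ffunE (bigD1 i) //= eqxx; congr (_ * _).
  by apply: eq_bigr => j /negPf ->.
apply/ffunP => f; rewrite pullF [RHS]ffunE [X in _ = X + _]ffunE !pullF.
by rewrite hcoord_linear mulrDl regular_scaleE mulrA.
Qed.

Lemma pull0 i : pull i 0 = 0.
Proof. by have := pull_linear i (-1) 0 0; rewrite scaler0 addr0 scaleN1r addNr.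
  Qed.

Lemma pullZ i (r : rat) (p : H) : pull i (r *: p) = r *: pull i p.
Proof. by have := pull_linear i r p 0; rewrite pull0 !addr0. Qed.

Lemma pull_sum i (I : finType) (F : I -> H) :
  pull i (\sum_s F s) = \sum_s pull i (F s).
Proof.
elim/big_rec2: _ => [|s t p _ <-]; first exact: pull0.
by have := pull_linear i 1 (F s) p; rewrite !scale1r.
Qed.

Lemma pull_homog i (k : nat) p : p \in deg k ->
  homog deg (fun j => if j == i then p else 1) (fun j => if j == i then k else
    0%N).
Proof. by move=> pk j; case: eqP => // _; apply: deg_unit HG. Qed.

Lemma sum_single i (k : nat) : (\sum_j (if j == i then k else 0) = k)%N.
Proof. by rewrite -big_mkcond big_pred1_eq. Qed.

Lemma thomog_pull i (k : nat) (p : H) : p \in deg k -> thomog k (pull i p).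
Proof. by move=> pk; have := thomog_pure HG (pull_homog i pk); rewrite
  sum_single. Qed.

Lemma pullC i j (k l : nat) (p q : H) : p \in deg k -> q \in deg l ->
  tmul (pull i p) (pull j q) = (-1) ^+ (k * l) *: tmul (pull j q) (pull i p).
Proof.
by move=> pk ql; rewrite !pullE (tmul_pureC HG (pull_homog i pk) (pull_homog j
  ql))
  !sum_single.
Qed.

Lemma pullM i (p q : H) : tmul (pull i p) (pull i q) = pull i (p * q).
Proof.
apply: (H_lin_ext (F := fun p => tmul (pull i p) (pull i q))
  (K := fun p => pull i (p * q))) p => [r p p'|r p p'|a].
- by rewrite pull_linear tmul_linearl.
- by rewrite mulrDl -scalerAl pull_linear.
apply: (H_lin_ext (F := fun q => tmul (pull i (hvec a)) (pull i q))
  (K := fun q => pull i (hvec a * q))) q => [r p p'|r p p'|b].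
- by rewrite pull_linear tmul_linearr.
- by rewrite mulrDr -scalerAr pull_linear.
rewrite !pullE (tmul_pure HG (pull_homog i (hvec_deg a)) (pull_homog i
  (hvec_deg b))).
rewrite (_ : cross _ _ = 0%N) ?scale1r.
  by apply: eq_pure => j; case: eqP => // _; rewrite mulr1.
rewrite /cross big1 // => j _; rewrite big1 // => k kj.
have [ji|_] := eqVneq j i; last by rewrite mul0n.
by rewrite -ji ifN ?muln0 // neq_ltn kj.
Qed.

Lemma thomog_diagonal i j : thomog (2 * m) (pull_diagonal i j).
Proof.
apply: thomog_sum => b _; apply: thomogZ.
rewrite -(subnKC (leq_ord (tag b))).
by apply: (thomog_tmul HG); apply: thomog_pull; [apply: hvec_deg|apply:
  (hdual_deg HG HF)].
Qed.

Lemma diagonal_central i j t : tmul (pull_diagonal i j) t = tmul t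
  (pull_diagonal i j).
Proof.
by apply: (thomog_even_central HG _ _ (thomog_diagonal (i := i) (j := j)));
  rewrite mul2n odd_double.
Qed.

Lemma signr_parity (k l : nat) : odd k = odd l -> (-1) ^+ k = (-1) ^+ l :> rat.
Proof. by rewrite -(signr_odd _ k) -(signr_odd _ l) => ->. Qed.

(** Multiplication by x on the basis in position i and on the dual basis in position j is given by
    one matrix and its transpose, with entries [integral (x * hvec b * hdual c)] up to sign. An
    entry is nonzero only if |c| = |x| + |b|, and then the signs agree. *)
Lemma pull_diagonalC i j (p : H) :
  tmul (pull i p) (pull_diagonal i j) = tmul (pull j p) (pull_diagonal i j).
Proof.
apply: (H_lin_ext (F := fun p => tmul (pull i p) (pull_diagonal i j))
  (K := fun p => tmul (pull j p) (pull_diagonal i j))) p => [r p p'|r p p'|a].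
- by rewrite pull_linear tmul_linearl.
- by rewrite pull_linear tmul_linearl.
set x := hvec a.
transitivity (\sum_b \sum_c ((-1) ^+ hdeg b * integral (x * hvec b * hdual c))
  *:
    tmul (pull i (hvec c)) (pull j (hdual b))).
  rewrite tmul_sumr; apply: eq_bigr => b _.
  rewrite tmulZr (tmulA HG) pullM [X in pull i X](hvec_expansion HG HF)
    pull_sum.
  rewrite tmul_suml scaler_sumr; apply: eq_bigr => c _.
  by rewrite pullZ tmulZl scalerA.
rewrite exchange_big tmul_sumr; apply: eq_bigr => c _ /=.
rewrite tmulZr (tmulA HG) (pullC j i (hvec_deg a) (hvec_deg c)) tmulZl -(tmulA
  HG) pullM.
rewrite [X in tmul _ (pull j X)](hdual_expansion HG HF) pull_sum tmul_sumr.
rewrite !scaler_sumr; apply: eq_bigr => b _; rewrite pullZ tmulZr !scalerA.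
congr (_ *: _); rewrite -/x (mulrA (hvec b)) (deg_comm HG (hvec_deg b)
  (hvec_deg a)).
rewrite -scalerAl integralZ -/x.
have [abc|abc] := eqVneq (hdeg a + hdeg b + (2 * m - hdeg c))%N (2 * m)%N; last
  first.
  rewrite (integral_homog w HG _ abc) ?mulr0 //.
  by apply: (deg_mul HG); [apply: (deg_mul HG); apply: hvec_deg|apply:
    (hdual_deg HG HF)].
rewrite mulrA -!exprD; congr (_ * _); apply: signr_parity.
have -> : hdeg c = (hdeg a + hdeg b)%N.
  have := leq_ord (tag c); rewrite -/(hdeg c) => c2m.
  by apply/eqP; rewrite -(eqn_add2r (2 * m - hdeg c)) abc subnKC.
by rewrite !(oddD, oddM); case: (odd (hdeg a)); case: (odd (hdeg b)).
Qed.

(** In the basis, Delta has the coefficients [integral (hdual c * hdual b)] up to sign; graded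
    commutativity and the even dimension 2m make them match under the exchange of b and c. *)
Lemma pull_diagonal_sym i j : pull_diagonal i j = pull_diagonal j i.
Proof.
transitivity (\sum_c \sum_b ((-1) ^+ hdeg c * integral (hdual c * hdual b)) *:
    tmul (pull i (hvec c)) (pull j (hvec b))).
  apply: eq_bigr => c _; rewrite [X in tmul _ (pull j X)](hvec_expansion HG HF).
  rewrite pull_sum tmul_sumr scaler_sumr; apply: eq_bigr => b _.
  by rewrite pullZ tmulZr scalerA.
rewrite exchange_big; apply: eq_bigr => b _ /=.
rewrite (pullC j i (hvec_deg b) (hdual_deg HG HF b)).
rewrite [X in pull i X](hvec_expansion HG HF) pull_sum tmul_suml !scaler_sumr.
apply: eq_bigr => c _; rewrite pullZ tmulZl !scalerA; congr (_ *: _).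
rewrite (integral_mulC w HG (hdual_deg HG HF b) (hdual_deg HG HF c)).
have b2m := leq_ord (tag b); have c2m := leq_ord (tag c).
rewrite -/(hdeg b) in b2m; rewrite -/(hdeg c) in c2m.
have [bc|bc] := eqVneq (2 * m - hdeg c + (2 * m - hdeg b))%N (2 * m)%N; last
  first.
  rewrite (integral_homog w HG _ bc) ?mulr0 //.
  by apply: (deg_mul HG); apply: (hdual_deg HG HF).
rewrite !mulrA -!exprD; congr (_ * _); apply: signr_parity.
have -> : hdeg c = (2 * m - hdeg b)%N.
  by apply/eqP; rewrite -(eqn_add2l (2 * m - hdeg c)) bc subnK.
rewrite subKn // !(oddD, oddM, oddB) //=.
by case: (odd (hdeg b)).
Qed.

(** Multiplication by w kills every term of Delta of positive degree in position i, and the degree 0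
    terms that remain are the expansion of w in the dual basis. In [lead_tensor_diagS] this converts
    each diagonal class into a factor w. *)
Lemma pull_w_diagonal i j :
  tmul (pull i w) (pull_diagonal i j) = tmul (pull i w) (pull j w).
Proof.
rewrite [X in _ = tmul _ (pull j X)](hdual_expansion HG HF w) pull_sum
  !tmul_sumr.
apply: eq_bigr => b _; rewrite pullZ !tmulZr (tmulA HG) pullM.
have [b0|b0] := eqVneq (hdeg b) 0%N.
  have wb : w * hvec b \in deg (2 * m).
    by have := deg_mul HG (w_deg HF) (hvec_deg b); rewrite b0 addn0.
  rewrite (integral_top HG HF wb) pullZ tmulZl b0 scale1r.
  by rewrite (integral_mulC w HG (w_deg HF) (hvec_deg b)) b0 muln0 mul1r.
have b2m : (2 * m < 2 * m + hdeg b)%N by rewrite -addn1 leq_add2l lt0n.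
have := deg_mul HG (w_deg HF) (hvec_deg b); rewrite (deg_high HG b2m) memv0 =>
  /eqP ->.
rewrite pull0 tmul0t scaler0 (integral_homog w HG (deg_mul HG (hvec_deg b)
  (w_deg HF))).
  by rewrite scale0r.
by rewrite neq_ltn addnC b2m orbT.
Qed.

(** Integration over X^n. It involves no Koszul sign, since only factors of the even degree 2m
    contribute. *)
Definition tintegral t : rat := \sum_f t f * \prod_i integral (hvec (f i)).

Lemma tintegral_linear (r : rat) t u :
  tintegral (r *: t + u) = r * tintegral t + tintegral u.
Proof.
rewrite /tintegral mulr_sumr -big_split; apply: eq_bigr => f _.
by rewrite !ffunE mulrDl regular_scaleE mulrA.
Qed.

Lemma tintegral0 : tintegral 0 = 0.
Proof. by rewrite /tintegral big1 // => f _; rewrite ffunE mul0r. Qed.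

Lemma tintegralZ (r : rat) t : tintegral (r *: t) = r * tintegral t.
Proof. by have := tintegral_linear r t 0; rewrite tintegral0 !addr0. Qed.

Lemma tintegral_pure x : tintegral (pure x) = \prod_i integral (x i).
Proof.
under [RHS]eq_bigr => i _ do rewrite [x i](hcoord_sum HG) integral_sum.
rewrite bigA_distr_bigA; apply: eq_bigr => f _; rewrite ffunE -big_split.
by apply: eq_bigr => i _; rewrite integralZ.
Qed.

Lemma tintegral_twist t : tintegral (twist t) = tintegral t.
Proof.
apply: eq_bigr => f _; rewrite ffunE.
have [/existsP[i fi]|/existsPn fi] := boolP [exists i, hdeg (f i) != (2 * m)%N].
  rewrite [X in _ * X = _](bigD1 i) //= [X in _ = _ * X](bigD1 i) //=.
  by rewrite (integral_homog w HG (hvec_deg (f i)) fi) mul0r !mulr0.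
rewrite -signr_odd (_ : odd _ = false) ?mul1r //.
rewrite /tdeg (eq_bigr (fun=> (2 * m)%N)); last by move=> i _;
  apply/eqP/negPn/fi.
by rewrite sum_nat_const mul2n -doubleMr odd_double.
Qed.

End PulledBackClasses.
(** * From the Kriz model to the Orlik-Solomon algebra *)

Section DiagonalTwist.
Import mathcomp.boot.fintype mathcomp.boot.bigop mathcomp.boot.finset.
Import mathcomp.boot.path mathcomp.boot.fingraph.
Variables (m n : nat) (H : falgType rat) (deg : nat -> {vspace H}) (w : H).
Hypotheses (HG : is_graded_algebra m deg) (HF : is_fundamental_class m deg w).
Local Notation integral := (@Defs.integral m H deg w).
Local Notation tensor := (tensor m n deg).
Local Notation tensor_index := (tensor_index m n deg).
Local Notation tone := (tone m n deg).
Local Notation pull := (@pull m n H deg).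
Local Notation pull_diagonal := (@pull_diagonal m n H deg w).
Local Notation twist := (@twist m n H deg).
Local Notation tintegral := (@tintegral m n H deg w).
Local Notation edge := (edge n).
Local Notation ext := (ext m n deg).
Local Notation os_ext := (os_ext n).
Implicit Types (t u v : tensor) (f g h : tensor_index) (i j k : 'I_n).
Implicit Types (p q : H) (S U V : {set edge}) (e : edge).
Implicit Types (a b : ext) (al be : os_ext).

(** * Products of diagonal classes *)

Lemma foldr_perm (A : eqType) (B : Type) (F : A -> B -> B) (z : B) (s s' : seq
  A) :
  (forall x y c, F x (F y c) = F y (F x c)) -> perm_eq s s' ->
  foldr F z s = foldr F z s'.
Proof.
move=> FC; elim: s s' => [|x s IHs] s' ss'.
  by move: ss'; rewrite perm_sym => /perm_nilP ->.
have xs' : x \in s' by rewrite -(perm_mem ss') mem_head.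
move: ss'; case/splitPr: xs' => s1 s2 ss'.
have {}ss' : perm_eq s (s1 ++ s2).
  by move: ss'; rewrite perm_sym -cat1s perm_catCA perm_sym /= perm_cons.
rewrite /= (IHs _ ss') !foldr_cat /=; elim: (s1) => //= y s1' <-.
by rewrite FC.
Qed.

Definition diag e : tensor := pull_diagonal (val e).1 (val e).2.

(** The factors are central because their degree 2m is even, so the order of [enum] does not
    matter. *)
Definition diagS S : tensor := foldr (fun e => tmul (diag e)) tone (enum S).

Lemma diag_central e t : tmul (diag e) t = tmul t (diag e).
Proof. exact: diagonal_central HG HF _ _ _. Qed.

Lemma diag_swap e e' t :
  tmul (diag e) (tmul (diag e') t) = tmul (diag e') (tmul (diag e) t).
Proof. by rewrite !(tmulA HG) (diag_central e (diag e')). Qed.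

Lemma diagS0 : diagS set0 = tone.
Proof. by rewrite /diagS enum_set0. Qed.

Lemma diagS_U S U : [disjoint S & U] -> diagS (S :|: U) = tmul (diagS S) (diagS
  U).
Proof.
move=> dSU; rewrite /diagS.
rewrite (@foldr_perm _ _ _ _ _ (enum S ++ enum U) diag_swap).
  rewrite foldr_cat; elim: (enum S) => [|e s IHs] /=; first by rewrite tmul1t.
  by rewrite IHs (tmulA HG).
apply: uniq_perm; rewrite ?enum_uniq //.
  rewrite cat_uniq !enum_uniq andbT /=; apply/hasPn => e; rewrite !mem_enum =>
    eU.
  by rewrite (disjointFl dSU eU).
by move=> e; rewrite mem_cat !mem_enum inE.
Qed.

Lemma diagS1 e : diagS [set e] = diag e.
Proof. by rewrite /diagS enum_set1 /= (tmult1 HG). Qed.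

Lemma diagS_U1 e S : e \notin S -> diagS (e |: S) = tmul (diag e) (diagS S).
Proof. by move=> eS; rewrite diagS_U ?diagS1 // disjoints1. Qed.

Lemma diagS_D1 e S : e \in S -> diagS S = tmul (diag e) (diagS (S :\ e)).
Proof. by move=> eS; rewrite -[in LHS](setD1K eS) diagS_U1 // !inE eqxx. Qed.

Lemma thomog_diagS S : thomog (#|S| * (2 * m)) (diagS S).
Proof.
rewrite /diagS cardE; elim: (enum S) => [|e s IHs] /=.
  have := thomog_pure HG (one_homog HG (n := n)); rewrite big1 //.
by rewrite mulSn; apply: (thomog_tmul HG) => //; apply: thomog_diagonal.
Qed.

Lemma diagS_central S t : tmul (diagS S) t = tmul t (diagS S).
Proof.
apply: (thomog_even_central HG _ _ (thomog_diagS (S := S))).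
by rewrite oddM mul2n odd_double andbF.
Qed.

Lemma iter_twist_diagS (r : nat) S : iter r twist (diagS S) = diagS S.
Proof.
apply: (iter_twist_even _ _ (thomog_diagS (S := S))).
by rewrite oddM mul2n odd_double andbF.
Qed.

Lemma pull_diagS_conn S i j p : conn S i j ->
  tmul (pull i p) (diagS S) = tmul (pull j p) (diagS S).
Proof.
case/connectP => s; elim: s i => [|k s IHs] i /=; first by move=> _ ->.
move=> /andP[/adj_genT[e eS eik] pths] jE; rewrite -(IHs k) //.
rewrite (diagS_D1 eS) !(tmulA HG); congr tmul; rewrite /diag.
case: eik => ->; first exact: pull_diagonalC.
by rewrite (pull_diagonalC HG HF).
Qed.

(** Next to Delta_jk the positions j and k are interchangeable. Hence, after [theta], the three
    products of an Arnold relator have the same coefficient. *)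
Lemma diagonal_arnold i j k :
  tmul (pull_diagonal i k) (pull_diagonal j k) =
  tmul (pull_diagonal i j) (pull_diagonal j k).
Proof.
rewrite !tmul_suml; apply: eq_bigr => b _; rewrite !tmulZl -!(tmulA HG).
by rewrite (pull_diagonalC HG HF).
Qed.

(* Replacing G_ij by Delta_ij G_ij is an algebra endomorphism which absorbs   *)
(* the cohomological relations, so that only the Arnold relations remain.     *)
Definition theta a : ext := [ffun S : {set edge} => tmul (a S) (diagS S)].

Lemma theta_linear (r : rat) a b : theta (r *: a + b) = r *: theta a + theta b.
Proof. by apply/ffunP => S; rewrite !ffunE tmul_linearl. Qed.

Lemma theta0 : theta 0 = 0.
Proof. by have := theta_linear (-1) 0 0; rewrite scaler0 addr0 scaleN1r addNr.
  Qed.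

Lemma thetaD a b : theta (a + b) = theta a + theta b.
Proof. by have := theta_linear 1 a b; rewrite !scale1r. Qed.

Lemma thetaZ (r : rat) a : theta (r *: a) = r *: theta a.
Proof. by have := theta_linear r a 0; rewrite theta0 !addr0. Qed.

Lemma thetaN a : theta (- a) = - theta a.
Proof. by rewrite -scaleN1r thetaZ scaleN1r. Qed.

Lemma theta_emul a b : theta (emul a b) = emul (theta a) (theta b).
Proof.
apply/ffunP => V; rewrite !ffunE tmul_suml; apply: eq_bigr => S SV.
rewrite tmulZl !ffunE; congr (_ *: _).
have -> : diagS V = tmul (diagS S) (diagS (V :\: S)).
  rewrite -diagS_U; last by rewrite -setI_eq0 setIDA setIC -setIDA setDv setI0.
  congr diagS; apply/setP => x; rewrite !inE.
  by case xS: (x \in S); rewrite //= (fintype.subsetP SV).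
rewrite (iter_twist_tmul HG) iter_twist_diagS -!(tmulA HG); congr tmul.
by rewrite !(tmulA HG) diagS_central.
Qed.

Definition tens t al : ext := [ffun S : {set edge} => al S *: t].

Lemma emul_tens t u al be : twist u = u ->
  emul (tens t al) (tens u be) = tens (tmul t u) (wedge al be).
Proof.
move=> uE; apply/ffunP => V; rewrite !ffunE scaler_suml; apply: eq_bigr => S _.
have iuE (r : nat) : iter r twist u = u by elim: r => //= r ->.
have := iter_twist_linear #|S| (be (V :\: S)) u 0.
rewrite iter_twist0 !addr0 iuE => tw.
by rewrite !ffunE tw tmulZl tmulZr !scalerA.
Qed.

Lemma coefE t : coef t = tens t (mono set0).
Proof.
by apply/ffunP => V; rewrite !ffunE; case: eqP => _; rewrite ?scale1r ?scale0r.
Qed.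

Lemma GE i j (ij : i != j) : G m deg ij = tens tone (gen ij).
Proof.
by apply/ffunP => V; rewrite !ffunE; case: eqP => _; rewrite ?scale1r ?scale0r.
Qed.

Lemma tens_linearr (r : rat) t al be :
  tens t (r *: al + be) = r *: tens t al + tens t be.
Proof. by apply/ffunP => V; rewrite !ffunE scalerDl scalerA. Qed.

Lemma tensDr t al be : tens t (al + be) = tens t al + tens t be.
Proof. by have := tens_linearr 1 t al be; rewrite !scale1r. Qed.

Lemma tens0r t : tens t 0 = 0.
Proof. by apply/ffunP => V; rewrite !ffunE scale0r. Qed.

Lemma tensZr (r : rat) t al : tens t (r *: al) = r *: tens t al.
Proof. by have := tens_linearr r t al 0; rewrite tens0r !addr0. Qed.

Lemma tensNr t al : tens t (- al) = - tens t al.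
Proof. by rewrite -scaleN1r tensZr scaleN1r. Qed.

Lemma tens_linearl (r : rat) t u al :
  tens (r *: t + u) al = r *: tens t al + tens u al.
Proof. by apply/ffunP => V; rewrite !ffunE scalerDr !scalerA mulrC. Qed.

Lemma theta_coef t : theta (coef t) = coef t.
Proof.
apply/ffunP => V; rewrite !ffunE; case: eqP => [->|_]; last by rewrite tmul0t.
by rewrite diagS0 (tmult1 HG).
Qed.

Lemma theta_G i j (ij : i != j) :
  theta (G m deg ij) = tens (pull_diagonal i j) (gen ij).
Proof.
rewrite GE; apply/ffunP => V; rewrite !ffunE tmulZl (tmul1t HG).
by case: eqP => [->|_]; rewrite ?scale0r // diagS1.
Qed.

Definition slice a f : os_ext := [ffun S => a S f].

Lemma slice_tens t al f : slice (tens t al) f = t f *: al.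
Proof. by apply/ffunP => V; rewrite !ffunE !regular_scaleE mulrC. Qed.

(** Membership in the tensor product of [tensor] with [os_ideal], tested on each coordinate. *)
Definition in_os_ideal a := forall f, os_ideal (slice a f).

Lemma twist_diagonal i j : twist (pull_diagonal i j) = pull_diagonal i j.
Proof.
have := iter_twist_even 1 _ (thomog_diagonal HG HF (i := i) (j := j)).
by apply; rewrite mul2n odd_double.
Qed.

(** The relators for p_i and p_j map to 0 by [pull_diagonalC]; the other two kinds map to a tensor
    times an Orlik-Solomon relator. *)
Lemma in_os_ideal_theta_relator a : kriz_relator a -> in_os_ideal (theta a).
Proof.
case=> [i j ij ji|i j ij p _|i j k ij jk ik ijk] f.
- rewrite thetaD thetaN !theta_G (pull_diagonal_sym HG HF j i) -tensNr -tensDr.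
  by rewrite slice_tens; apply/os_idealZ/os_ideal_relator/os_relator_sym.
- rewrite thetaD thetaN !theta_emul !theta_coef !theta_G !coefE.
  rewrite !emul_tens ?twist_diagonal // (pull_diagonalC HG HF) subrr.
  rewrite (_ : slice 0 f = 0); first exact: os_ideal0.
  by apply/ffunP => V; rewrite !ffunE.
rewrite !(thetaD, thetaN) !theta_emul !theta_G !emul_tens ?twist_diagonal //.
rewrite diagonal_arnold.
have -> : tmul (pull_diagonal i j) (pull_diagonal i k) =
    tmul (pull_diagonal i j) (pull_diagonal j k).
  rewrite -[LHS](diagonal_central HG HF) -[RHS](diagonal_central HG HF).
  rewrite (pull_diagonal_sym HG HF i k) (pull_diagonal_sym HG HF j k).
  by rewrite -diagonal_arnold.
rewrite -!(tensNr, tensDr) slice_tens.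
by apply/os_idealZ/os_ideal_relator/os_relator_arnold.
Qed.

(** The signs from moving tensors past G_S are put on the left factor, where they amount to a power
    of [bar], under which [os_ideal] is stable. *)
Lemma slice_emul a b h : slice (emul a b) h =
  \sum_f \sum_g (koszul_sign f g * \prod_i hcoord (hvec (f i) * hvec (g i)) (h
    i)) *:
    wedge [ffun S : {set edge} => (-1) ^+ (#|S| * tdeg g) * a S f] (slice b g).
Proof.
apply/ffunP => V; rewrite ffunE ffunE !sum_ffunE.
rewrite (eq_bigr (fun S : {set edge} => \sum_f \sum_g
    (koszul_sign f g * \prod_i hcoord (hvec (f i) * hvec (g i)) (h i)) *
    (shuffle_sign S (V :\: S) * ((-1) ^+ (#|S| * tdeg g) * a S f) * b (V :\: S)
      g))).
  rewrite exchange_big; apply: eq_bigr => f _ /=.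
  rewrite sum_ffunE exchange_big; apply: eq_bigr => g _ /=.
  rewrite ffunE regular_scaleE ffunE mulr_sumr; apply: eq_bigr => S _.
  by rewrite !ffunE.
move=> S _; rewrite !ffunE regular_scaleE mulr_sumr; apply: eq_bigr => f _.
rewrite mulr_sumr; apply: eq_bigr => g _; rewrite iter_twistE.
by move: (koszul_sign f g) (\prod_i _) (shuffle_sign _ _) (_ ^+ _) (a S f)
  (b (V :\: S) g) => x1 x2 x3 x4 x5 x6; rewrite /GRing.regular in x5 x6 *; ring.
Qed.

Lemma in_os_ideal_emull a b : in_os_ideal b -> in_os_ideal (emul a b).
Proof.
move=> Jb h; rewrite slice_emul; apply: os_ideal_sum => f _; apply:
  os_ideal_sum => g _.
by apply/os_idealZ/os_idealMl.
Qed.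

Lemma bar_iter_ideal (r : nat) al : os_ideal al ->
  os_ideal [ffun S : {set edge} => (-1) ^+ (#|S| * r) * al S].
Proof.
move=> Jal; elim: r => [|r /os_ideal_bar_del[Jr _]].
  rewrite (_ : [ffun _ => _] = al) //.
  by apply/ffunP => S; rewrite ffunE muln0 mul1r.
rewrite (_ : [ffun _ => _] =
    bar [ffun S : {set edge} => (-1) ^+ (#|S| * r) * al S]) //.
by apply/ffunP => S; rewrite !ffunE mulrA -exprD mulnS.
Qed.

Lemma in_os_ideal_emulr a b : in_os_ideal a -> in_os_ideal (emul a b).
Proof.
move=> Ja h; rewrite slice_emul; apply: os_ideal_sum => f _; apply:
  os_ideal_sum => g _.
apply/os_idealZ/os_idealMr; have := bar_iter_ideal (tdeg g) (Ja f).
congr os_ideal; apply/ffunP => S; by rewrite !ffunE.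
Qed.

Lemma in_os_ideal_theta a : kriz_ideal a -> in_os_ideal (theta a).
Proof.
elim=> [r /in_os_ideal_theta_relator //||{}a b _ Ja _ Jb|r {}a _ Ja
       |{}a b _ Jb|{}a b _ Ja] f.
- rewrite theta0 (_ : slice 0 f = 0); first exact: os_ideal0.
  by apply/ffunP => V; rewrite !ffunE.
- rewrite thetaD (_ : slice _ f = slice (theta a) f + slice (theta b) f).
    exact: os_idealD.
  by apply/ffunP => V; rewrite !ffunE.
- rewrite thetaZ (_ : slice _ f = r *: slice (theta a) f).
    exact: os_idealZ.
  by apply/ffunP => V; rewrite !ffunE.
- by rewrite theta_emul; apply: in_os_ideal_emull.
- by rewrite theta_emul; apply: in_os_ideal_emulr.
Qed.

(* If S is a forest, integrating t * diagS S over X^n is integrating t over   *)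
(* the partial diagonal of S; in this form the compatibility with d, lemma    *)
(* trace_ediff, is immediate.                                                 *)
Definition trace a : os_ext := [ffun S : {set edge} => tintegral (tmul (a S)
  (diagS S))].

Lemma trace_linear (r : rat) a b : trace (r *: a + b) = r *: trace a + trace b.
Proof. by apply/ffunP => S; rewrite !ffunE tmul_linearl tintegral_linear. Qed.

(** [trace a] is a fixed linear combination of the slices of [theta a]. *)
Lemma trace_ideal a : kriz_ideal a -> os_ideal (trace a).
Proof.
move=> /in_os_ideal_theta Ja.
have -> : trace a = \sum_(f : tensor_index) (\prod_i integral (hvec (f i))) *:
  slice (theta a) f.
  apply/ffunP => S; rewrite sum_ffunE ffunE; apply: eq_bigr => f _.
  by rewrite !ffunE regular_scaleE mulrC.
by apply: os_ideal_sum => f _; apply: os_idealZ.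
Qed.

(** The factor Delta_e produced by d is the one that completes [diagS V] to [diagS (e |: V)]; the
    twist is invisible to the integral. *)
Lemma trace_ediff a : trace (ediff w a) = del (trace a).
Proof.
apply/ffunP => V; rewrite !ffunE tmul_suml.
have tsum (I : finType) (P : pred I) (F : I -> tensor) :
    tintegral (\sum_(s | P s) F s) = \sum_(s | P s) tintegral (F s).
  elim/big_rec2: _ => [|s y x _ <-]; first exact: tintegral0.
  by have := tintegral_linear w 1 (F s) x; rewrite scale1r mul1r.
rewrite tsum; apply: eq_bigr => e eV; rewrite tmulZl.
rewrite tintegralZ ffunE; congr (_ * _).
rewrite -(tmulA HG) -diagS_U1 // -[in LHS](iter_twist_diagS 1 (e |: V)) /=.
by rewrite -(twist_tmul HG) (tintegral_twist w HG).
Qed.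

End DiagonalTwist.
(** * The top subcomplex *)

Section TopSubcomplex.
Import mathcomp.boot.fintype mathcomp.boot.bigop mathcomp.boot.finset.
Import mathcomp.boot.path mathcomp.boot.fingraph.
Variables (m n : nat) (H : falgType rat) (deg : nat -> {vspace H}) (w : H).
Hypotheses (HG : is_graded_algebra m deg) (HF : is_fundamental_class m deg w).
Local Notation integral := (@Defs.integral m H deg w).
Local Notation tensor := (tensor m n deg).
Local Notation tensor_index := (tensor_index m n deg).
Local Notation tone := (tone m n deg).
Local Notation pull := (@pull m n H deg).
Local Notation pure := (@pure m n H deg).
Local Notation pull_diagonal := (@pull_diagonal m n H deg w).
Local Notation twist := (@twist m n H deg).
Local Notation tintegral := (@tintegral m n H deg w).
Local Notation diagS := (@diagS m n H deg w).
Local Notation trace := (@trace m n H deg w).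
Local Notation edge := (edge n).
Local Notation ext := (ext m n deg).
Local Notation os_ext := (os_ext n).
Implicit Types (t u v : tensor) (f g h : tensor_index) (i j k : 'I_n).
Implicit Types (p q : H) (S U V : {set edge}) (e : edge).
Implicit Types (a b : ext) (al be : os_ext).

Lemma setUD_sub U V : U \subset V -> U :|: V :\: U = V.
Proof.
move=> UV; apply/setP => e; rewrite !inE.
by case eU: (e \in U); rewrite //= (fintype.subsetP UV).
Qed.

Lemma kriz_idealN a : kriz_ideal a -> kriz_ideal (- a).
Proof. by move=> Ia; rewrite -scaleN1r; apply: idealZ. Qed.

Lemma kriz_ideal_sum (I : finType) (P : pred I) (F : I -> ext) :
  (forall x, P x -> kriz_ideal (F x)) -> kriz_ideal (\sum_(x | P x) F x).
Proof. by move=> JF; apply: big_ind => //; [apply: ideal0|apply: idealD]. Qed.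

Lemma emul_coefl t a : emul (coef t) a = [ffun V => tmul t (a V)].
Proof.
apply/ffunP => V; rewrite !ffunE (bigD1 set0) ?sub0set //= big1 => [|S /andP[_
  S0]].
  rewrite ffunE eqxx setD0 shuffle_sign0l scale1r cards0 addr0 //.
by rewrite ffunE (negPf S0) tmul0t scaler0.
Qed.

Lemma emul_monol U a V : emul (tens tone (mono U)) a V =
  if U \subset V then shuffle_sign U (V :\: U) *: iter #|U| twist (a (V :\: U))
    else 0.
Proof.
rewrite ffunE; case: ifP => UV.
  rewrite (bigD1 U) //= big1 => [|S /andP[_ SU]].
    by rewrite !ffunE eqxx scale1r (tmul1t HG) addr0.
  by rewrite !ffunE (negPf SU) scale0r tmul0t scaler0.
rewrite big1 // => S SV; rewrite !ffunE; case: eqP => [SU|_].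
  by rewrite -SU SV in UV.
by rewrite scale0r tmul0t scaler0.
Qed.

Lemma emul_monor U a V : emul a (tens tone (mono U)) V =
  if U \subset V then shuffle_sign (V :\: U) U *: a (V :\: U) else 0.
Proof.
have VVU (S W : {set edge}) : S \subset W -> W :\: (W :\: S) = S.
  by move=> SW; rewrite setDDr setDv set0U; apply/setIidPr.
rewrite ffunE; case: ifP => UV.
  rewrite (bigD1 (V :\: U)) ?subsetDl //= big1 => [|S /andP[SV SU]].
    rewrite VVU // !ffunE eqxx scale1r addr0.
    suff -> : iter #|V :\: U| twist tone = tone by rewrite (tmult1 HG).
    by elim: #|_| => //= r ->; apply: twist_tone.
  rewrite !ffunE; case: eqP => [VS|_]; last by rewrite scale0r iter_twist0
    tmult0 scaler0.
  by rewrite -VS VVU // eqxx in SU.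
rewrite big1 // => S SV; rewrite !ffunE; case: eqP => [VS|_].
  by rewrite -VS subsetDl in UV.
by rewrite scale0r iter_twist0 tmult0 scaler0.
Qed.

Lemma twist1 : twist tone = tone.
Proof. exact: twist_tone. Qed.

Lemma kriz_ideal_tens al t : os_ideal al -> kriz_ideal (tens t al).
Proof.
move=> Jal; elim: Jal t => [r Rr||{}al be _ IHa _ IHb|x {}al _ IHa
    |{}al be _ IHb|{}al be _ IHa] t.
- have -> : tens t r = emul (coef t) (tens tone r).
    by rewrite coefE emul_tens ?twist1 // (tmult1 HG) wedge1l.
  apply/idealMl/ideal_relator.
  case: Rr => [i j ij ji|i j k ij jk ik ijk].
    by rewrite tensDr tensNr -!GE; apply: relator_sym.
  have tens_wedge be ga : tens tone (wedge be ga) = emul (tens tone be) (tens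
    tone ga).
    by rewrite emul_tens ?twist1 // (tmul1t HG).
  rewrite !(tensDr, tensNr) !tens_wedge -!GE.
  exact: relator_arnold.
- by rewrite tens0r; apply: ideal0.
- by rewrite tensDr; apply: idealD.
- by rewrite tensZr; apply: idealZ.
- by rewrite -[t](tmult1 HG) -emul_tens ?twist1 //; apply: idealMl.
- by rewrite -[t](tmult1 HG) -emul_tens ?twist1 //; apply: Defs.idealMr.
Qed.

(* The coefficients c may vary with the monomial, as long as they only see    *)
(* the partition of the vertices that it induces: the Arnold relations are    *)
(* homogeneous for this grading by partitions.                                *)
Definition family (c : {set edge} -> tensor) al : ext :=
  [ffun S : {set edge} => al S *: c S].

Definition conn_invariant (c : {set edge} -> tensor) :=
  forall S U, (forall x y, conn S x y = conn U x y) -> c S = c U.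

Lemma conn_generate S U :
  (forall e, e \in S -> conn U (val e).1 (val e).2) -> subrel (conn S) (conn U).
Proof.
move=> SU; apply: connect_sub => x y /adj_genT[e eS []] exy; have := SU e eS;
  by rewrite exy //= conn_sym.
Qed.

(** Any two edges of a triangle connect its three vertices, so all monomials of a relator induce the
    same partition. *)
Lemma os_relator_conn al : os_relator al ->
  exists U, forall S, al S != 0 -> forall x y, conn S x y = conn U x y.
Proof.
case=> [i j ij ji|i j k ij jk ik ijk].
  pose eij : edge := exist _ (i, j) ij; pose eji : edge := exist _ (j, i) ji.
  exists [set eij] => S; have [->|Sji] := eqVneq S [set eji].
    move=> _ x y; apply/idP/idP; apply: conn_generate => e; rewrite inE => /eqP
      -> /=.
      by rewrite conn_sym; apply: (conn_edge (set11 eij)).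
    by rewrite conn_sym; apply: (conn_edge (set11 eji)).
  have [->//|Sij] := eqVneq S [set eij].
  by case/eqP; rewrite !ffunE (negPf Sji) (negPf Sij) subrr.
pose eij : edge := exist _ (i, j) ij; pose ejk : edge := exist _ (j, k) jk.
pose eik : edge := exist _ (i, k) ik.
exists [set eij; ejk; eik].
have two (e e' : edge) S : wedge (mono [set e]) (mono [set e']) S != 0 -> S =
  [set e; e'].
  have [->|ee'] := eqVneq e e'.
    by rewrite (@wedge_mono_meet _ _ _ e') ?inE // ffunE eqxx.
  rewrite wedge_mono_disjoint; last by rewrite disjoints1 inE.
  by rewrite !ffunE; case: (S =P _) => // _; rewrite scaler0 eqxx.
have subE (x y z : os_ext) S : (x - (y - z)) S = x S - (y S - z S).
  by rewrite !ffunE.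
have cases S : (wedge (gen ik) (gen jk) -
    (wedge (gen ij) (gen jk) - wedge (gen ij) (gen ik))) S != 0 ->
    [\/ S = [set eik; ejk], S = [set eij; ejk] | S = [set eij; eik]].
  rewrite subE; have [->|/two ->] := eqVneq (wedge (gen ik) (gen jk) S) 0.
    have [->|/two ->] := eqVneq (wedge (gen ij) (gen jk) S) 0.
      have [->|/two ->] := eqVneq (wedge (gen ij) (gen ik) S) 0.
        by rewrite !subr0 eqxx.
      by constructor 3.
    by constructor 2.
  by constructor 1.
move=> S /cases SE x y; apply/idP/idP.
  apply: conn_sub; case: SE => ->; apply/fintype.subsetP => e;
  by rewrite !inE => /orP[] ->; rewrite ?orbT.
apply: conn_generate => e; rewrite !inE -orbA => /or3P[] /eqP -> /=.
- case: SE => ->.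
  + apply: (@conn_trans _ _ k); first exact: (conn_edge (set21 eik ejk)).
    by rewrite conn_sym; apply: (conn_edge (set22 eik ejk)).
  + exact: (conn_edge (set21 eij ejk)).
  + exact: (conn_edge (set21 eij eik)).
- case: SE => ->.
  + exact: (conn_edge (set22 eik ejk)).
  + exact: (conn_edge (set22 eij ejk)).
  + apply: (@conn_trans _ _ i); last exact: (conn_edge (set22 eij eik)).
    by rewrite conn_sym; apply: (conn_edge (set21 eij eik)).
- case: SE => ->.
  + exact: (conn_edge (set21 eik ejk)).
  + apply: (@conn_trans _ _ j); first exact: (conn_edge (set21 eij ejk)).
    exact: (conn_edge (set22 eij ejk)).
  + exact: (conn_edge (set22 eij eik)).
Qed.

(** On a relator the family is constant by [os_relator_conn]. For a product, the outer factor is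
    expanded in monomials [mono U], and c is replaced by the family [c (U :|: _)] on the inner
    factor, which still sees only partitions. *)
Lemma kriz_ideal_family al c : os_ideal al -> conn_invariant c ->
  kriz_ideal (family c al).
Proof.
move=> Jal; elim: Jal c => [r Rr||{}al be _ IHa _ IHb|x {}al _ IHa
    |{}al be _ IHb|{}al be _ IHa] c cc.
- have [U UE] := os_relator_conn Rr.
  rewrite (_ : family c r = tens (c U) r); last first.
    apply/ffunP => S; rewrite !ffunE; have [->|rS] := eqVneq (r S) 0.
      by rewrite !scale0r.
    by rewrite (cc _ _ (UE S rS)).
  exact/kriz_ideal_tens/os_ideal_relator.
- rewrite (_ : family c 0 = 0); first exact: ideal0.
  by apply/ffunP => S; rewrite !ffunE scale0r.
- rewrite (_ : family c _ = family c al + family c be).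
    by apply: idealD; [apply: IHa|apply: IHb].
  by apply/ffunP => S; rewrite !ffunE scalerDl.
- rewrite (_ : family c _ = x *: family c al); first by apply/idealZ/IHa.
  by apply/ffunP => S; rewrite !ffunE scalerA.
(* The iterated twist cancels the one that [emul] applies when the coefficient moves left past
   G_U. *)
- rewrite (_ : family c _ = \sum_U al U *: emul (tens tone (mono U))
      (family (fun S => iter #|U| twist (c (U :|: S))) be)).
    apply: kriz_ideal_sum => U _; apply/idealZ/idealMl/IHb => S S' SS'.
    by congr (iter _ _ _); apply: cc => x y; apply: connUl.
  apply/ffunP => V; rewrite sum_ffunE !ffunE scaler_suml [LHS]big_mkcond /=.
  apply: eq_bigr => U _; rewrite ffunE emul_monol; case: ifP => UV; last by
    rewrite scaler0.
  rewrite ffunE.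
  have := iter_twist_linear #|U| (be (V :\: U)) (iter #|U| twist (c (U :|: V
    :\: U))) 0.
  rewrite iter_twist0 !addr0 iter_twistK => ->; rewrite !scalerA.
  rewrite setUD_sub //.
  by congr (_ *: _); rewrite -mulrA; apply: mulrCA.
- rewrite (_ : family c _ = \sum_U be U *: emul
      (family (fun S => c (U :|: S)) al) (tens tone (mono U))).
    apply: kriz_ideal_sum => U _; apply/idealZ/Defs.idealMr/IHa => S S' SS'.
    by apply: cc => x y; apply: connUl.
  apply/ffunP => V; rewrite sum_ffunE !ffunE scaler_suml.
  rewrite [RHS](bigID (fun U : {set edge} => U \subset V)) /= [X in _ + X]big1
    => [|U UV].
    rewrite addr0 (reindex_onto (fun U => V :\: U) (fun U => V :\: U)) /=; last
      first.
      by move=> U UV; rewrite setDDr setDv set0U; apply/setIidPr.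
    apply: congr_big => [//|U|U /andP[_ /eqP UV]].
      rewrite subsetDl /=; apply/eqP/idP => [<-|UV]; first exact: subsetDl.
      by rewrite setDDr setDv set0U; apply/setIidPr.
    rewrite UV ffunE emul_monor -UV subsetDl UV ffunE !scalerA.
    rewrite setUD_sub; last by rewrite -UV subsetDl.
    by congr (_ *: _); rewrite -[RHS]mulrA; apply: mulrC.
  by rewrite ffunE emul_monor (negPf UV) scaler0.
Qed.

(* For a forest S the second condition says that t restricts to 0 on the      *)
(* partial diagonal x_i = x_j, ij in S, of X^n, whose class is diagS S.       *)
Definition annihilates S t :=
  kriz_ideal (tens t (mono S)) /\ tmul t (diagS S) = 0.

Lemma annihilates0 S : annihilates S 0.
Proof.
split; last exact: tmul0t.
rewrite (_ : tens 0 _ = 0); first exact: ideal0.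
by apply/ffunP => V; rewrite !ffunE scaler0.
Qed.

Lemma annihilatesD S t u : annihilates S t -> annihilates S u -> annihilates S
  (t + u).
Proof.
move=> [It tS] [Iu uS]; split; last by rewrite tmulDl tS uS addr0.
by have := tens_linearl 1 t u (mono S); rewrite !scale1r => ->; apply: idealD.
Qed.

Lemma annihilatesZ S (r : rat) t : annihilates S t -> annihilates S (r *: t).
Proof.
move=> [It tS]; split; last by rewrite tmulZl tS scaler0.
have := tens_linearl r t 0 (mono S); rewrite addr0 => ->; apply: idealD.
  exact: idealZ.
by case: (annihilates0 S).
Qed.

Lemma annihilates_mull S t u : annihilates S t -> annihilates S (tmul u t).
Proof.
move=> [It tS]; split; last by rewrite -(tmulA HG) tS tmult0.
rewrite (_ : tens _ _ = emul (coef u) (tens t (mono S))); first exact: idealMl.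
by rewrite emul_coefl; apply/ffunP => V; rewrite !ffunE tmulZr.
Qed.

Lemma kriz_ideal_pull e p :
  kriz_ideal (tens (pull (val e).1 p - pull (val e).2 p) (mono [set e])).
Proof.
have main i j (ij : i != j) : (i < j)%N ->
    kriz_ideal (tens (pull i p - pull j p) (gen ij)).
  move=> lij; have := ideal_relator (relator_pull m deg ij p lij).
  rewrite GE !coefE !emul_tens ?twist1 // !(tmult1 HG) wedge1l => /kriz_idealN.
  congr kriz_ideal; apply/ffunP => V; rewrite !ffunE.
  by rewrite opprB scalerBr.
case: e => [[i j] ij] /=; have ij' : i != j by [].
rewrite -[mono _]/(gen ij) (bool_irrelevance ij ij').
have [lij|lji|/val_inj eij] := ltngtP i j; last by have /eqP[] := ij'; exact:
  eij.
  exact: main.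
have ji : j != i by rewrite eq_sym.
rewrite -[gen ij'](subrK (gen ji)) tensDr; apply: idealD.
  by apply/kriz_ideal_tens/os_ideal_relator/os_relator_sym.
rewrite -opprB; have := kriz_idealN (main _ _ ji lji).
by congr kriz_ideal; apply/ffunP => V; rewrite !ffunE scalerN.
Qed.

Lemma annihilates_pull S i j p : conn S i j -> annihilates S (pull i p - pull j
  p).
Proof.
move=> ij; split; last first.
  by rewrite tmulBl (pull_diagS_conn HG HF p ij) subrr.
case/connectP: ij => s; elim: s i => [i _ ->|k s IHs i] /=.
  rewrite subrr; by case: (annihilates0 S).
move=> /andP[/adj_genT[e eS eik] pths] jE.
have -> : tens (pull i p - pull j p) (mono S) =
    tens (pull i p - pull k p) (mono S) + tens (pull k p - pull j p) (mono S).
  by apply/ffunP => V; rewrite !ffunE -scalerDr addrA subrK.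
apply: idealD; last exact: IHs.
rewrite (mono_setD1 eS) tensZr; apply: idealZ.
rewrite -[pull i p - _](tmult1 HG) -emul_tens ?twist1 //; apply: Defs.idealMr.
have := kriz_ideal_pull e p; case: eik => -> //= /kriz_idealN.
by congr kriz_ideal; apply/ffunP => V; rewrite !ffunE -scalerN opprB.
Qed.

(** A tensor that restricts to the fundamental class of the partial diagonal of S, with one factor w
    for each component. *)
Definition lead_tensor S : tensor := pure (fun i => if i \in leaders S then w
  else 1).

Lemma lead_tensor_conn : conn_invariant lead_tensor.
Proof. by move=> S U SU; rewrite /lead_tensor (leaders_eq SU). Qed.

Lemma lead_homog S : homog deg (fun i => if i \in leaders S then w else 1)
  (fun i => if i \in leaders S then 2 * m else 0)%N.
Proof. by move=> i; case: ifP => _; [apply: w_deg|apply: deg_unit HG]. Qed.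

Lemma thomog_lead_tensor S : thomog (#|leaders S| * (2 * m)) (lead_tensor S).
Proof.
have := thomog_pure HG (lead_homog S).
by rewrite -big_mkcond sum_nat_const.
Qed.

(* Inside one component of S all the factors of a tensor can be multiplied    *)
(* into the position of the leader.                                           *)
Lemma collect_leaders S (x : 'I_n -> H) (d : 'I_n -> nat) : homog deg x d ->
  exists (r : rat) y d', [/\ homog deg y d', (\sum_i d' i = \sum_i d i)%N,
    forall i, i \notin leaders S -> y i = 1 /\ d' i = 0%N &
    annihilates S (pure x - r *: pure y)].
Proof.
have [k] := ubnP #|[set i | (i \notin leaders S) && ((x i != 1) || (d i !=
  0%N))]|.
elim: k => // k IHk in x d *; rewrite ltnS => Sk xd.
have [/existsP[i /andP[iS ixd]]|stop] :=
    boolP [exists i, (i \notin leaders S) && ((x i != 1) || (d i != 0%N))];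
      last first.
  exists 1, x, d; split=> //; last by rewrite scale1r subrr; apply:
    annihilates0.
  move=> i iS; have /existsPn/(_ i) := stop; rewrite iS /= negb_or !negbK.
  by move=> /andP[/eqP -> /eqP ->].
pose l := leader S i; have lS : l \in leaders S := leader_leaders S i.
have li : l != i by apply: contraNneq iS => <-.
(* The factor [x i] is taken out (x1) and multiplied into the position of the leader l (x2); the
   number of positions outside the leaders still to be cleared drops. *)
pose x1 j := if j == i then 1 else x j.
pose d1 j := if j == i then 0%N else d j.
have xd1 : homog deg x1 d1.
  by move=> j; rewrite /x1 /d1; case: eqP => // _; apply: deg_unit HG.
have px1 := tmul_pure HG xd1 (pull_homog HG i (xd i)).
have px2 := tmul_pure HG xd1 (pull_homog HG l (xd i)).
set r1 := (-1) ^+ _ in px1; set r2 := (-1) ^+ _ in px2.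
set x2 := fun j => x1 j * _ in px2.
pose d2 j := (d1 j + if j == l then d i else 0)%N.
have xd2 : homog deg x2 d2.
  exact (pureM_homog HG xd1 (pull_homog HG l (xd i))).
have sd2 : (\sum_j d2 j = \sum_j d j)%N.
  rewrite big_split /= sum_single [RHS](bigD1 i) //= addnC; congr (_ + _)%N.
  rewrite (bigD1 i) //= /d1 eqxx add0n; apply: eq_bigr => j /negPf -> //.
have [|r [y [d' [yd' sd' yS ann]]]] := IHk x2 d2 _ xd2.
  apply: leq_trans Sk; apply: proper_card; apply/properP; split.
    apply/fintype.subsetP => j; rewrite in_set => /andP[jS].
    have jl : j != l by apply: contraNneq jS => ->.
    rewrite in_set jS /x2 /d2 /x1 /d1 (negPf jl) mulr1 addn0.
    by case: (j == i); rewrite ?eqxx.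
  exists i; first by rewrite in_set iS ixd.
  by rewrite in_set iS /x2 /d2 /x1 /d1 eqxx [i == l]eq_sym (negPf li) mulr1
    eqxx.
exists (r1 * r2 * r), y, d'; split=> //; first by rewrite sd'.
have r1K : r1 * r1 = 1 by rewrite -expr2 sqrr_sign.
have -> : pure x = r1 *: tmul (pure x1) (pull i (x i)).
  rewrite [X in _ *: X]px1 scalerA r1K scale1r; apply: eq_pure => j.
  by rewrite /x1; case: eqP => [->|_]; rewrite ?mul1r ?mulr1.
have -> : r1 *: tmul (pure x1) (pull i (x i)) - (r1 * r2 * r) *: pure y =
    r1 *: tmul (pure x1) (pull i (x i) - pull l (x i)) +
    (r1 * r2) *: (pure x2 - r *: pure y).
  by rewrite tmulBr [X in r1 *: (_ - X)]px2 !scalerBr !scalerA addrA subrK.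
apply: annihilatesD; last exact: annihilatesZ.
apply/annihilatesZ/annihilates_mull/annihilates_pull.
exact: conn_leader.
Qed.

(** After collection the factors at the leaders have total degree 2m times their number, and none
    exceeds 2m unless it is zero. So each has degree 2m and is a multiple of w. *)
Lemma reduce_to_lead_tensor S t : thomog (#|leaders S| * (2 * m)) t ->
  exists r : rat, annihilates S (t - r *: lead_tensor S).
Proof.
move=> td; elim/(@thomog_ind m n H deg HG): td => [|t1 t2 [r1 h1] [r2 h2]|r t1
  [r1 h1]|f fd].
- by exists 0; rewrite scale0r subrr; apply: annihilates0.
- exists (r1 + r2); rewrite scalerDl opprD addrACA; exact: annihilatesD.
- exists (r * r1); rewrite -scalerA -scalerBr; exact: annihilatesZ.
have [r [y [d [yd sd yS ann]]]] := collect_leaders S (hvec_homog f).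
have {}sd : (\sum_(i in leaders S) d i = #|leaders S| * (2 * m))%N.
  rewrite -fd /tdeg -sd [RHS](bigID (mem (leaders S))) /= [X in (_ + X)%N]big1
    ?addn0 //.
  by move=> i /yS[].
suff [r' yE] : exists r' : rat, pure y = r' *: lead_tensor S.
  by exists (r * r'); rewrite -scalerA -yE.
have [/existsP[i /eqP yi0]|/existsPn y0] := boolP [exists i, y i == 0].
  by exists 0; rewrite scale0r; apply: pure0 yi0.
have d_le i : (d i <= 2 * m)%N.
  rewrite leqNgt; apply: contra (y0 i) => di.
  by have := yd i; rewrite (deg_high HG di) memv0.
have d_top i : i \in leaders S -> d i = (2 * m)%N.
  move=> iS; apply/eqP; rewrite eqn_leq d_le /= leqNgt; apply/negP => di.
  suff : (\sum_(i in leaders S) d i < #|leaders S| * (2 * m))%N by rewrite sd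
    ltnn.
  rewrite -sum_nat_const (bigD1 i) //= [ltnRHS](bigD1 i) //= -addSn leq_add //.
  by apply: leq_sum => j _; apply: d_le.
exists (\prod_i (if i \in leaders S then integral (y i) else 1)).
rewrite -pureZ; apply: eq_pure => i; case: ifP => iS; last first.
  by rewrite scale1r; case: (yS i (negbT iS)).
by apply: (integral_top HG HF); rewrite -(d_top i iS).
Qed.

Lemma w_even : ~~ odd (2 * m).
Proof. by rewrite mul2n odd_double. Qed.

Lemma pull_w_central i t : tmul (pull i w) t = tmul t (pull i w).
Proof.
have wi := thomog_pull HG (i := i) (w_deg HF).
exact: (thomog_even_central HG t w_even wi).
Qed.

Lemma even_cross (d d' : 'I_n -> nat) : (forall i, ~~ odd (d i)) ->
  (-1) ^+ cross d d' = 1 :> rat.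
Proof.
move=> ed; rewrite -signr_odd (_ : odd _ = false) //.
rewrite /cross; elim/big_rec: _ => // i s _; rewrite oddD => ->; rewrite addbF.
elim/big_rec: _ => // j s' _; rewrite oddD oddM => ->.
by rewrite (negPf (ed i)).
Qed.

Lemma pure_add_w (A : {set 'I_n}) i : i \notin A ->
  pure (fun j => if j \in i |: A then w else 1) =
  tmul (pure (fun j => if j \in A then w else 1)) (pull i w).
Proof.
move=> iA; pose d j := (if j \in A then 2 * m else 0)%N.
have Ad : homog deg (fun j => if j \in A then w else 1) d.
  by move=> j; rewrite /d; case: ifP => _; [apply: w_deg|apply: deg_unit HG].
rewrite (tmul_pure HG Ad (pull_homog HG i (w_deg HF))) even_cross ?scale1r;
  last first.
  by move=> j; rewrite /d; case: ifP => // _; apply: w_even.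
apply: eq_pure => j; rewrite in_setU1; case: eqP => [->|_] /=; last by rewrite
  mulr1.
by rewrite (negPf iA) mul1r.
Qed.

(** Edges are removed one at a time: with w present at the leader a, the class Delta_e of the bridge
    acts as w at b, which is the new leader in [S :\ e]. At the end every vertex carries w. *)
Lemma lead_tensor_diagS S : forest S -> tmul (lead_tensor S) (diagS S) = pure
  (fun=> w).
Proof.
have [k] := ubnP #|S|; elim: k => // k IHk in S * => Sk fS.
have [->|/set0Pn[e eS]] := eqVneq S set0.
  by rewrite diagS0 (tmult1 HG); apply: eq_pure => i; rewrite leaders0 inE.
have [nce fS'] := forest_bridge fS eS.
have [a [b [bS lE aS ends]]] := leaders_bridge eS nce.
rewrite -(IHk (S :\ e)) //; last first.
  by move: Sk; rewrite (cardsD1 e S) eS add1n ltnS.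
rewrite (diagS_D1 HG HF eS); set D := diagS (S :\ e).
have key : tmul (pull a w) (tmul (diag m deg w e) D) =
    tmul (pull a w) (tmul (pull b w) D).
  have pw i j : conn (S :\ e) i j -> tmul (pull i w) D = tmul (pull j w) D.
    by move=> ij; apply: pull_diagS_conn.
  have step i j c d : conn (S :\ e) i c -> conn (S :\ e) j d ->
      tmul (pull c w) (tmul (pull_diagonal i j) D) =
      tmul (pull c w) (tmul (pull d w) D).
    move=> ic jd; rewrite (tmulA HG) pull_w_central -(tmulA HG) -(pw i c) //.
    rewrite (tmulA HG) -pull_w_central (pull_w_diagonal HG HF) -(tmulA HG) (pw
      j d) //.
    by rewrite (tmulA HG) pull_w_central -(tmulA HG) (pw i c) // !(tmulA HG)
      -pull_w_central.
  case/orP: ends => /andP[c1 c2]; first exact: step.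
  by rewrite /diag (pull_diagonal_sym HG HF); apply: step.
have -> : lead_tensor S =
    tmul (pure (fun j => if j \in leaders S :\ a then w else 1)) (pull a w).
  rewrite -pure_add_w; last by rewrite !inE eqxx.
  by apply: eq_pure => j; rewrite setD1K.
rewrite -(tmulA HG) key !(tmulA HG) -pure_add_w; last by rewrite !inE eqxx.
by rewrite (setD1K aS) -(pure_add_w bS) -lE.
Qed.

Lemma trace_lead_tensor S : forest S ->
  tintegral (tmul (lead_tensor S) (diagS S)) = 1.
Proof.
move=> fS; rewrite lead_tensor_diagS // (tintegral_pure w HG).
by rewrite big1 // => i _; apply: integral_w.
Qed.

(** * Comparison in the degrees of the subcomplex *)

Hypothesis m_gt0 : (0 < m)%N.

(** A coefficient has degree 2m for each of the n - q components of a forest with q edges. *)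
Lemma top_degree_tdeg (q d : nat) : (q <= n)%N ->
  (d + q * (2 * m).-1 = top_degree m n q)%N <-> d = ((n - q) * (2 * m))%N.
Proof.
move=> qn; rewrite /top_degree.
have [M mE] : exists M, (2 * m = M.+1)%N by case: (m) m_gt0 => // m' _; exists
  (2 * m').+1; lia.
rewrite mE /= mulnSr; have := subnK qn; move: (n - q)%N => l <-.
by rewrite mulnDl; split; lia.
Qed.

(** On a forest the multiple of [lead_tensor S] to which [a S] reduces must be [trace a S], because
    [lead_tensor S] has trace 1 there; the other monomials lie in the ideal with any coefficient. *)
Lemma trace_family (q : nat) a : (q < n)%N ->
  bihomogeneous q (top_degree m n q) a ->
  kriz_ideal (a - family lead_tensor (trace a)).
Proof.
move=> qn aq.
have -> : a - family lead_tensor (trace a) =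
    \sum_S tens (a S - trace a S *: lead_tensor S) (mono S).
  apply/ffunP => V; rewrite sum_ffunE (bigD1 V) //= big1 => [|S SV].
    by rewrite !ffunE eqxx scale1r addr0.
  by rewrite !ffunE eq_sym (negPf SV) scale0r.
apply: kriz_ideal_sum => S _; have [fS|/not_forest_os_ideal] := boolP (forest
  S); last first.
  exact: kriz_ideal_tens.
have aS : thomog (#|leaders S| * (2 * m)) (a S).
  move=> f /aq[Sq]; rewrite top_degree_tdeg 1?ltnW // => ->; congr (_ * _)%N.
  by rewrite forest_card // Sq.
have [r [Ir ann]] := reduce_to_lead_tensor aS.
suff -> : trace a S = r by [].
rewrite ffunE -[a S](subrK (r *: lead_tensor S)) tmulDl ann add0r tmulZl.
by rewrite tintegralZ trace_lead_tensor // mulr1.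
Qed.

Lemma trace_inj (q : nat) a : (q < n)%N -> bihomogeneous q (top_degree m n q) a
  ->
  os_ideal (trace a) -> kriz_ideal a.
Proof.
move=> qn aq Ja; rewrite -(subrK (family lead_tensor (trace a)) a).
apply: idealD; first exact: trace_family qn aq.
exact: (kriz_ideal_family Ja lead_tensor_conn).
Qed.

Lemma bihomogeneous_ediff (q : nat) a : (q < n)%N ->
  bihomogeneous q.+1 (top_degree m n q.+1) a ->
  bihomogeneous q (top_degree m n q) (ediff w a).
Proof.
move=> qn aq V f; rewrite ffunE => df.
have [e eV ef] : exists2 e, e \notin V &
    tmul (twist (a (e |: V))) (diag m deg w e) f != 0.
  apply/exists_inP; apply: contraNT df => /exists_inPn h; rewrite sum_ffunE
    big1 //.
  by move=> e eV; rewrite ffunE (eqP (negPn (h e eV))) scaler0.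
have [f' af'] : exists f', a (e |: V) f' != 0.
  apply/existsP; apply: contraNT ef => /existsPn a0.
  suff -> : a (e |: V) = 0 by rewrite twist0 tmul0t ffunE.
  by apply/ffunP => f'; rewrite ffunE; apply/eqP/negPn/a0.
have [cV _] := aq _ _ af'; rewrite cardsU1 eV add1n in cV; case: cV => cV.
split=> //; rewrite top_degree_tdeg 1?ltnW //.
have ad : thomog ((n - q.+1) * (2 * m)) (a (e |: V)).
  by move=> g /aq[_]; rewrite top_degree_tdeg.
have td : thomog ((n - q.+1) * (2 * m)) (twist (a (e |: V))).
  by rewrite (twist_homog ad); apply: thomogZ.
rewrite (thomog_tmul HG td (thomog_diagonal HG HF (i := (val e).1) (j := (val
  e).2)) ef).
by rewrite addnC -mulSn subnSK.
Qed.

Lemma trace_wedge_lift (al : os_ext) (q : nat) : (q < n)%N ->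
  (forall S, al S != 0 -> #|S| = q) ->
  exists2 b, bihomogeneous q (top_degree m n q) b & os_ideal (trace b - al).
Proof.
(* On a non-forest [lead_tensor S] would have too large a degree. The value 0 keeps the lift
   bihomogeneous and changes the trace only within [os_ideal]. *)
move=> qn alq; pose c S := if forest S then lead_tensor S else 0.
exists (family c al).
  move=> S f; rewrite ffunE ffunE => alS.
  have Sq : #|S| = q.
    by apply: alq; apply: contraNneq alS => ->; rewrite regular_scaleE mul0r.
  have cS : c S f != 0 by apply: contraNneq alS => ->; rewrite regular_scaleE
    mulr0.
  split=> //; rewrite top_degree_tdeg 1?ltnW //; move: cS; rewrite /c.
  case: ifP => [fS|_]; last by rewrite ffunE eqxx.
  by move/thomog_lead_tensor ->; rewrite forest_card // Sq.
have -> : trace (family c al) - al = \sum_(S | ~~ forest S) (- al S) *: mono S.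
  rewrite [trace _]os_ext_mono [X in _ - X](os_ext_mono al) -sumrB.
  rewrite [LHS](bigID (@forest n)) /= big1 ?add0r => [|S fS].
    apply: eq_bigr => S fS; rewrite -scalerBl !ffunE /c (negPf fS) scaler0
      tmul0t.
    by rewrite tintegral0 sub0r.
  rewrite -scalerBl !ffunE /c fS tmulZl tintegralZ trace_lead_tensor // mulr1.
  by rewrite subrr scale0r.
by apply: os_ideal_sum => S fS; apply/os_idealZ/not_forest_os_ideal.
Qed.

(* Left multiplication by one generator contracts the Orlik-Solomon complex.  *)
Lemma top_acyclic : (1 < n)%N -> top_subcomplex_acyclic m n deg w.
Proof.
move=> n2 q qn a [aq Ida].
have n0 : (0 < n)%N by apply: ltnW.
have ij : Ordinal n0 != Ordinal n2 by [].
pose e : edge := exist _ (_, _) ij.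
pose be := wedge (mono [set e]) (trace a).
have Jda : os_ideal (del (trace a)).
  by rewrite -trace_ediff //; apply: trace_ideal.
(* The contracting homotopy: the derivation rule for G_e times the trace, with [del] of G_e equal to
   1. *)
have aE : trace a = del be + wedge (mono [set e]) (del (trace a)).
  rewrite del_wedge del_mono1 wedge1l bar_mono cards1 expr1 scaleN1r wedgeNl.
  by rewrite subrK.
have beq S : be S != 0 -> #|S| = q.+1.
  rewrite wedge_monol; case: ifP => [eS|_]; last by rewrite eqxx.
  rewrite mulf_eq0 negb_or => /andP[_]; rewrite ffunE => tS.
  have [f /aq[cS _]] : exists f, a (S :\: [set e]) f != 0.
    apply/existsP; apply: contraNT tS => /existsPn a0.
    suff -> : a (S :\: [set e]) = 0 by rewrite tmul0t tintegral0.
    by apply/ffunP => f; rewrite ffunE; apply/eqP/negPn/a0.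
  by rewrite (cardsD1 e) -sub1set eS add1n cS.
have [q1n|] := ltnP q.+1 n.
  have [b bq Jb] := trace_wedge_lift q1n beq.
  exists b; rewrite q1n; split=> //; apply: (trace_inj qn).
    have subE (x y : ext) V f : (x - y) V f = x V f - y V f by rewrite !ffunE.
    move=> V f; rewrite subE => abf; have [aV|/aq//] := eqVneq (a V f) 0.
    by apply: (bihomogeneous_ediff qn bq); apply: contraNneq abf => h; rewrite
      aV h subrr.
  have -> : trace (a - ediff w b) = trace a - del (trace b).
    have := trace_linear w (-1) (ediff w b) a.
    by rewrite !scaleN1r addrC trace_ediff // addrC => ->; rewrite addrC.
  (* What is left is [del] of the error of the lift, and G_e times [del (trace a)], which is in the
     ideal because a is a cycle. *)
  rewrite aE addrAC; apply: os_idealD; last exact: os_idealMl.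
  rewrite -opprB -delN -delD; apply: os_idealN.
  by have [_] := os_ideal_bar_del Jb.
(* Here q = n-1: [be] is supported on sets of n edges, so it lies in [os_ideal], and a is already
   zero in the model. *)
move=> nq; exists 0; rewrite ltnNge nq /=; split=> //.
have -> : ediff w (0 : ext) = 0.
  apply/ffunP => V; rewrite !ffunE big1 // => f _.
  by rewrite ffunE twist0 tmul0t scaler0.
rewrite subr0.
apply: (trace_inj qn aq); rewrite aE; apply: os_idealD; last exact: os_idealMl.
suff Jbe : os_ideal be by have [_] := os_ideal_bar_del Jbe.
rewrite [be]os_ext_mono; apply: os_ideal_sum => S _.
have [->|/beq Sq] := eqVneq (be S) 0; first by rewrite scale0r; apply:
  os_ideal0.
by apply/os_idealZ/card_os_ideal; rewrite // Sq.
Qed.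

End TopSubcomplex.

Theorem proposition1p4 (R : realType) (N m n : nat)
    (X : set (projective_space R N))
    (H : falgType rat) (deg : nat -> {vspace H})
    (cl : forall k, cochain R (set_type X) k -> H) (w : H)
    (m_ge1 : (1 <= m)%N) (n_ge2 : (2 <= n)%N)
    (X_smooth_projective : connected_smooth_projective m X)
    (H_cohomology : is_cohomology_ring deg cl)
    (H_graded : is_graded_algebra m deg)
    (w_fundamental : is_fundamental_class m deg w) :
  top_subcomplex_acyclic m n deg w.
Proof. exact: top_acyclic. Qed.
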